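(* Let $H$ be a complex Hilbert space, and let $\mathcal{A}$ be a Banach subalgebra of the operator algebra $\mathcal{B}(H)$ that admits norm-controlled inversion in $\mathcal{B}(H)$. If $A,B,Q\in\mathcal{A}$, and $A,B$ are normal operators in $\mathcal{B}(H)$ with their spectra in $\mathcal{B}(H)$ being disjoint, then there is a bivariate function $g$ on $\mathbb{R}_+\times\mathbb{R}_+$ that is bounded on any compact subset of $\mathbb{R}_+\times\mathbb{R}_+$ such that $$\|X\|_{\mathcal{A}}\le g\big((d(A,B))^{-1},\ \|A\|_{\mathcal{A}}+\|B\|_{\mathcal{A}}\big)$$ holds for the unique solution $X$ of the operator Sylvester equation $BX-XA=Q$, where $d(A,B)$ is the distance of the spectra of $A$ and $B$ in $\mathcal{B}(H)$.
   Context: $\mathbb{R}_+$ is the set of all nonnegative real numbers. $\mathcal{B}(H)$ is the $C^\star$-algebra of all bounded linear operators on $H$. For Banach algebras $\mathcal{A}$ and $\mathcal{B}$, $\|\cdot\|_{\mathcal{A}}$ and $\|\cdot\|_{\mathcal{B}}$ denote their norms. A subalgebra $\mathcal{A}$ of a Banach algebra $\mathcal{B}$ sharing the same identity $I$ with $\mathcal{B}$ is inverse-closed in $\mathcal{B}$ if any element of $\mathcal{A}$ that is invertible in $\mathcal{B}$ is also invertible in $\mathcal{A}$. An inverse-closed Banach subalgebra $\mathcal{A}$ of $\mathcal{B}$ admits norm-controlled inversion in $\mathcal{B}$ if there exists a nonnegative function $h:\mathbb{R}_+\times\mathbb{R}_+\to\mathbb{R}_+$ that is bounded on any compact subset of $\mathbb{R}_+\times\mathbb{R}_+$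 such that $\|A^{-1}\|_{\mathcal{A}}\le h(\|A^{-1}\|_{\mathcal{B}},\|A\|_{\mathcal{A}})$ for all $A\in\mathcal{A}$ that are invertible in $\mathcal{B}$. An operator $A\in\mathcal{B}(H)$ is normal if $A^\star A=AA^\star$. The distance of the spectra is $d(A,B)=\inf\{|z-w|:\ z\in\sigma_{\mathcal{B}(H)}(A),\ w\in\sigma_{\mathcal{B}(H)}(B)\}$, where $\sigma_{\mathcal{B}(H)}(\cdot)$ denotes the spectrum in $\mathcal{B}(H)$. *)

(* Defs.v *)
From Stdlib Require Import Reals List.
From Coquelicot Require Import Coquelicot.

Set Implicit Arguments.
Open Scope R_scope.

(** * Functions bounded on compact subsets of the closed quadrant *)

(* The constant [compact] of [Reals] is restricted to subsets of [R]. *)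
Definition cover_compact {T : UniformSpace} (K : T -> Prop) : Prop :=
  forall (I : Type) (U : I -> T -> Prop),
    (forall i, open (U i)) ->
    (forall x, K x -> exists i, U i x) ->
    exists l : list I, forall x, K x -> exists i, In i l /\ U i x.

Definition in_quadrant (p : R * R) : Prop := 0 <= fst p /\ 0 <= snd p.

(* A function on the quadrant is represented by a total function on the plane
   of which only the values on the quadrant are ever constrained or used. *)
Definition bounded_on_compacts (h : R -> R -> R) : Prop :=
  forall K : R * R -> Prop,
    cover_compact K ->
    (forall p, K p -> in_quadrant p) ->
    exists M : R, forall p, K p -> Rabs (h (fst p) (snd p)) <= M.

(** * Complex Hilbert spaces *)

(* [inner] is linear in the first argument; [inner_norm] gives positivity and
   definiteness, and says that the complete norm is the Hilbert norm. *)
Record HilbertSpace : Type := {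
  hilbert_space :> CompleteNormedModule C_AbsRing;
  inner : hilbert_space -> hilbert_space -> C;
  inner_conj : forall x y, inner y x = Cconj (inner x y);
  inner_plus : forall x y z, inner (plus x y) z = Cplus (inner x z) (inner y z);
  inner_scal : forall (a : C) x y, inner (scal a x) y = Cmult a (inner x y);
  inner_norm : forall x, inner x x = RtoC (norm x ^ 2)
}.

Arguments inner {h} x y : rename.

(** * Operators *)

Section Operators.

Context {H : HilbertSpace}.

Implicit Types (S T X A B Q : H -> H) (P : (H -> H) -> Prop).

Definition op_one : H -> H := fun x => x.
Definition op_plus S T : H -> H := fun x => plus (S x) (T x).
Definition op_minus S T : H -> H := fun x => minus (S x) (T x).
Definition op_scal (a : C) T : H -> H := fun x => scal a (T x).
Definition op_mult S T : H -> H := fun x => S (T x).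

(* The algebra B(H): Coquelicot's [is_linear] includes boundedness. *)
Definition BH T : Prop := is_linear T.

Definition opnorm T : R :=
  real (Lub_Rbar (fun r => exists x : H, norm x <= 1 /\ r = norm (T x))).

Definition is_adjoint T S : Prop :=
  BH S /\ forall x y : H, inner (T x) y = inner x (S y).

(* The adjoint of a bounded operator exists and is unique. *)
Definition normal T : Prop :=
  exists S, is_adjoint T S /\ op_mult S T = op_mult T S.

Definition is_inverse T S : Prop :=
  op_mult T S = op_one /\ op_mult S T = op_one.

Definition invertible_in P T : Prop := exists S, P S /\ is_inverse T S.

Definition spectrum T (z : C) : Prop :=
  ~ invertible_in BH (op_minus T (op_scal z op_one)).

(* If [H] is the zero space, both spectra are empty, the infimum is [p_infty]
   and [spectral_dist] is 0. Since [/ 0 = 0], the value of [/ spectral_dist A B]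
   is then the expected 1/oo = 0. *)
Definition spectral_dist A B : R :=
  real (Glb_Rbar (fun r => exists z w : C,
    spectrum A z /\ spectrum B w /\ r = Cmod (Cminus z w))).

Definition sylvester_solution A B Q X : Prop :=
  op_minus (op_mult B X) (op_mult X A) = Q.

(** * Banach subalgebras of B(H) *)

(* Only the values of [alg_norm] on the carrier are meaningful. No continuity
   of the inclusion into B(H) is required. *)
Record BanachSubalgebra : Type := {
  carrier :> (H -> H) -> Prop;
  alg_norm : (H -> H) -> R;
  carrier_BH : forall T, carrier T -> BH T;
  carrier_one : carrier op_one;
  carrier_plus : forall S T, carrier S -> carrier T -> carrier (op_plus S T);
  carrier_scal : forall (a : C) T, carrier T -> carrier (op_scal a T);
  carrier_mult : forall S T, carrier S -> carrier T -> carrier (op_mult S T);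
  alg_norm_ge0 : forall T, carrier T -> 0 <= alg_norm T;
  alg_norm_eq0 : forall T, carrier T -> alg_norm T = 0 -> T = (fun _ => zero);
  alg_norm_plus : forall S T, carrier S -> carrier T ->
    alg_norm (op_plus S T) <= alg_norm S + alg_norm T;
  alg_norm_scal : forall (a : C) T, carrier T ->
    alg_norm (op_scal a T) = Cmod a * alg_norm T;
  alg_norm_mult : forall S T, carrier S -> carrier T ->
    alg_norm (op_mult S T) <= alg_norm S * alg_norm T;
  alg_complete : forall u : nat -> H -> H,
    (forall n, carrier (u n)) ->
    (forall eps : posreal, exists N : nat, forall n m : nat,
       (N <= n)%nat -> (N <= m)%nat -> alg_norm (op_minus (u n) (u m)) < eps) ->
    exists T, carrier T /\
      is_lim_seq (fun n => alg_norm (op_minus (u n) T)) 0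
}.

Definition inverse_closed (alg : BanachSubalgebra) : Prop :=
  forall T, alg T -> invertible_in BH T -> invertible_in alg T.

Definition norm_controlled_inversion (alg : BanachSubalgebra) : Prop :=
  inverse_closed alg /\
  exists h : R -> R -> R,
    (forall s t, 0 <= s -> 0 <= t -> 0 <= h s t) /\
    bounded_on_compacts h /\
    forall T S, alg T -> BH S -> is_inverse T S ->
      alg_norm alg S <= h (opnorm S) (alg_norm alg T).

End Operators.

Arguments BanachSubalgebra H : clear implicits.

(* Main.v *)
Require Import Defs.
From Stdlib Require Import Reals ZArith Lra Lia List.
From Stdlib Require Import Classical ClassicalEpsilon FunctionalExtensionality.
From Coquelicot Require Import Coquelicot.
Import ListNotations.
Open Scope R_scope.

(** The classical solution is the contour integral of [(B-z)^-1 Q (A-z)^-1]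
    along a contour separating the spectrum of [A] from that of [B]; on it the
    operator norms of the resolvents of the normal operators are at most the
    inverse of the distance to the spectrum, so norm-controlled inversion bounds
    their norms in the algebra. No integral is needed: the contour is replaced
    by edges of a fine square grid, with the midpoint rule on each edge. Summation
    by parts over the grid gives [B X0 - X0 A = Q PA - PB Q] exactly, where [PA]
    and [PB] are the corresponding sums of the resolvents alone, and the quadrature
    error leaves [PA] close to a scalar [- k] with [|k| >= 4] and [PB] close to 0.
    Hence [- X0 / k] solves the equation up to [|Q| / 2], and successive
    approximation in the algebra gives a solution. If [B Y = Y A], the same
    identity in [B(H)] reads [Y PA = PB Y], whence [Y = 0].

    The resolvent bound rests on [|S x|^2 <= |x| |S^2 x|] for [S] the inverse of a
    normal operator, and on an elementary form of the spectral radius formula. *)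

(** * Identities in complex modules *)

(** The function [g] may not depend on [A] and [B], and this shapes the order of the choices. For
    each integer [n], one box, one mesh and one bound on the resolvents serve all pairs with norms
    at most [n] and spectra at distance at least [/ n]; only the set of selected squares depends on
    the pair. The constants so obtained, one per integer, are assembled into a step function.
    Resolvents exist only off the spectra, but sums range over whole squares. The resolvent maps are
    therefore total, with value zero where nothing is known, and the grid identities ask for genuine
    inverses only on edges that separate selected from rejected squares or lie on the outer
    boundary: all others cancel. The scalar [k] stands for [2 pi i]. The bound 4 is a cheap
    substitute for [2 pi]; with two errors of size at most 1 it gives the contraction factor
    [2 / 4]. Uniqueness is claimed among all bounded operators, which may lie outside the
    subalgebra, so B(H) is itself made a [BanachSubalgebra] and the same grid is used there. *)

Inductive mexp : Type :=
  | MVar (i : nat)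
  | MZero
  | MPlus (a b : mexp)
  | MMinus (a b : mexp)
  | MOpp (a : mexp)
  | MScal (c : C) (a : mexp).

Fixpoint meval {V : ModuleSpace C_Ring} (env : list V) (e : mexp) : V :=
  match e with
  | MVar i => nth i env zero
  | MZero => zero
  | MPlus a b => plus (meval env a) (meval env b)
  | MMinus a b => minus (meval env a) (meval env b)
  | MOpp a => opp (meval env a)
  | MScal c a => scal c (meval env a)
  end.

Fixpoint mcoef (e : mexp) (j : nat) : C :=
  match e with
  | MVar i => if Nat.eqb i j then RtoC 1 else RtoC 0
  | MZero => RtoC 0
  | MPlus a b => Cplus (mcoef a j) (mcoef b j)
  | MMinus a b => Cminus (mcoef a j) (mcoef b j)
  | MOpp a => Copp (mcoef a j)
  | MScal c a => Cmult c (mcoef a j)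
  end.

Fixpoint mcomb {V : ModuleSpace C_Ring} (c : nat -> C) (env : list V) (k : nat) : V :=
  match env with
  | nil => zero
  | v :: env => plus (scal (c k) v) (mcomb c env (S k))
  end.

(** Recursion on [env] makes the statement reduce to a conjunction with one equation in C per atom,
    ready for [ring] or [field]. *)
Fixpoint mcoef_eq {V : Type} (e1 e2 : mexp) (env : list V) (k : nat) : Prop :=
  match env with
  | nil => True
  | _ :: env => mcoef e1 k = mcoef e2 k /\ mcoef_eq e1 e2 env (S k)
  end.

Section ModuleNormalisation.
Context {V : ModuleSpace C_Ring}.
Implicit Types (env : list V).

Lemma plus_swap4 (a b c d : V) :
  plus (plus a b) (plus c d) = plus (plus a c) (plus b d).
Proof.
  rewrite <- !plus_assoc. f_equal. rewrite !plus_assoc. f_equal. apply plus_comm.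
Qed.

Lemma mcomb_ext c c' env k :
  (forall j, c j = c' j) -> mcomb c env k = mcomb c' env k.
Proof.
  intros E; revert k; induction env as [|v env IH]; intros k; cbn; [easy|].
  now rewrite E, IH.
Qed.

Lemma mcomb_zero env k : mcomb (fun _ => RtoC 0) env k = zero.
Proof.
  revert k; induction env as [|v env IH]; intros k; cbn; [easy|].
  rewrite IH, plus_zero_r. apply (scal_zero_l (V := V)).
Qed.

Lemma mcomb_plus c d env k :
  mcomb (fun j => Cplus (c j) (d j)) env k = plus (mcomb c env k) (mcomb d env k).
Proof.
  revert k; induction env as [|v env IH]; intros k; cbn.
  - now rewrite plus_zero_l.
  - rewrite IH, plus_swap4. f_equal. apply (scal_distr_r (V := V)).
Qed.

Lemma mcomb_scal a c env k :
  mcomb (fun j => Cmult a (c j)) env k = scal a (mcomb c env k).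
Proof.
  revert k; induction env as [|v env IH]; intros k; cbn.
  - symmetry; apply scal_zero_r.
  - rewrite IH, scal_distr_l. f_equal. symmetry; apply (scal_assoc (V := V)).
Qed.

Lemma opp_scal_m1 (x : V) : opp x = scal (RtoC (-1)) x.
Proof.
  rewrite <- (scal_opp_one (V := V)). f_equal.
  apply injective_projections; cbn; ring.
Qed.

Lemma mcomb_opp c env k :
  mcomb (fun j => Copp (c j)) env k = opp (mcomb c env k).
Proof.
  rewrite opp_scal_m1, <- mcomb_scal. apply mcomb_ext. intros j.
  apply injective_projections; cbn; ring.
Qed.

Lemma mcomb_var i env k :
  mcomb (fun j => if Nat.eqb (i + k) j then RtoC 1 else RtoC 0) env k
  = nth i env zero.
Proof.
  revert i k; induction env as [|v env IH]; intros i k; cbn [mcomb nth].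
  - now destruct i.
  - destruct i as [|i].
    + rewrite Nat.add_0_l, Nat.eqb_refl.
      replace (scal (RtoC 1) v) with v by (symmetry; apply (scal_one (V := V))).
      rewrite <- (plus_zero_r v) at 2. f_equal.
      assert (E : forall n, (k < n)%nat ->
        mcomb (fun j => if Nat.eqb k j then RtoC 1 else RtoC 0) env n = zero).
      { clear. induction env as [|w env IH]; intros n Hn; cbn [mcomb]; [easy|].
        rewrite IH by lia. rewrite plus_zero_r.
        destruct (Nat.eqb_spec k n); [lia|]. apply (scal_zero_l (V := V)). }
      apply E; lia.
    + destruct (Nat.eqb_spec (S i + k) k) as [?|_]; [lia|].
      rewrite <- (IH i (S k)).
      replace (scal (RtoC 0) v) with (zero : V)
        by (symmetry; apply (scal_zero_l (V := V))).
      rewrite plus_zero_l. apply mcomb_ext. intros j.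
      now replace (S i + k)%nat with (i + S k)%nat by lia.
Qed.

Lemma meval_mcomb e env : meval env e = mcomb (mcoef e) env 0.
Proof.
  induction e as [i| |a IHa b IHb|a IHa b IHb|a IHa|c a IHa]; cbn [meval mcoef].
  - rewrite <- mcomb_var with (k := O). apply mcomb_ext. intros j. cbn.
    now rewrite Nat.add_0_r.
  - symmetry; apply mcomb_zero.
  - rewrite (mcomb_plus (mcoef a) (mcoef b)). congruence.
  - unfold Cminus. rewrite (mcomb_plus (mcoef a) (fun j => Copp (mcoef b j))).
    rewrite (mcomb_opp (mcoef b)). unfold minus. now rewrite IHa, IHb.
  - rewrite (mcomb_opp (mcoef a)). now rewrite IHa.
  - rewrite (mcomb_scal c (mcoef a)). now rewrite IHa.
Qed.

Lemma mcoef_eq_mcomb e1 e2 env k :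
  mcoef_eq e1 e2 env k -> mcomb (mcoef e1) env k = mcomb (mcoef e2) env k.
Proof.
  revert k; induction env as [|v env IH]; intros k; cbn [mcoef_eq mcomb]; [easy|].
  intros [E E']. now rewrite E, (IH _ E').
Qed.

Lemma meval_eq e1 e2 env :
  mcoef_eq e1 e2 env 0 -> meval env e1 = meval env e2.
Proof. intros E. rewrite !meval_mcomb. now apply mcoef_eq_mcomb. Qed.

End ModuleNormalisation.

Ltac m_mem x l :=
  lazymatch l with
  | nil => constr:(false)
  | cons x _ => constr:(true)
  | cons _ ?l' => m_mem x l'
  end.

Ltac m_idx x l :=
  lazymatch l with
  | cons x _ => constr:(O)
  | cons _ ?l' => let n := m_idx x l' in constr:(S n)
  end.

Ltac m_atoms l t :=
  lazymatch t with
  | plus ?a ?b => let l := m_atoms l a in m_atoms l b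
  | minus ?a ?b => let l := m_atoms l a in m_atoms l b
  | opp ?a => m_atoms l a
  | scal _ ?a => m_atoms l a
  | zero => l
  | _ => let b := m_mem t l in
         lazymatch b with true => l | false => constr:(cons t l) end
  end.

Ltac m_reify l t :=
  lazymatch t with
  | plus ?a ?b => let a := m_reify l a in let b := m_reify l b in constr:(MPlus a b)
  | minus ?a ?b => let a := m_reify l a in let b := m_reify l b in constr:(MMinus a b)
  | opp ?a => let a := m_reify l a in constr:(MOpp a)
  | scal ?c ?a => let a := m_reify l a in constr:(MScal c a)
  | zero => constr:(MZero)
  | _ => let n := m_idx t l in constr:(MVar n)
  end.

(* Reduces an identity between linear combinations of vectors to the identities
   between their coefficients, in the field of complex numbers. *)
Ltac module_coef V :=
  lazymatch goal with
  | |- ?a = ?b =>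
    let l := m_atoms (@nil V) a in
    let l := m_atoms l b in
    let ea := m_reify l a in
    let eb := m_reify l b in
    change (meval (V := V) l ea = meval (V := V) l eb);
    apply meval_eq;
    cbv beta iota zeta delta [mcoef_eq mcoef Nat.eqb];
    repeat split
  end.

Section HilbertSpaceOperators.
Context {H : HilbertSpace}.

(** The same space as a module over [C_Ring], the ring over which [meval] is stated; the two
    structures are convertible, which the [change] in [module_coef] relies on. *)
Definition Hmod : ModuleSpace C_Ring := NormedModule.ModuleSpace C_AbsRing H.

End HilbertSpaceOperators.

Ltac module :=
  let V := lazymatch goal with |- @eq (hilbert_space ?H) _ _ => constr:(@Hmod H)
  | |- @eq ?T _ _ => lazymatch T with context [hilbert_space ?H] => constr:(@Hmod H) end end in
  module_coef V; try ring.

(** * The Banach algebra of bounded operators *)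

Section OperatorNorm.
Context {H : HilbertSpace}.
Implicit Types (x y z : H) (S T : H -> H).

(** [norm_scal] is one inequality; the other is the same one for the inverse of [a]. *)
Lemma normH_scal (a : C) x : norm (scal a x) = Cmod a * norm x.
Proof.
  apply Rle_antisym; [exact (norm_scal (V := H) a x)|].
  destruct (classic (a = RtoC 0)) as [->|ha].
  - rewrite Cmod_0, Rmult_0_l. apply norm_ge_0.
  - assert (ha' : 0 < Cmod a) by now apply Cmod_gt_0.
    replace x with (scal (Cinv a) (scal a x)) at 1.
    + apply Rle_trans with (Cmod a * (Cmod (Cinv a) * norm (scal a x))).
      * apply Rmult_le_compat_l; [lra|]. exact (norm_scal (V := H) _ _).
      * rewrite Cmod_inv by easy. right. field. lra.
    + transitivity (scal (RtoC 1) x); [|module].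
      module. now field.
Qed.

Lemma normH_zero : norm (zero : H) = 0.
Proof. exact (norm_zero (V := H)). Qed.

Lemma normH_eq0 x : norm x = 0 -> x = zero.
Proof. exact (norm_eq_zero (V := H) x). Qed.

Lemma normH_triangle x y : norm (plus x y) <= norm x + norm y.
Proof. exact (norm_triangle (V := H) x y). Qed.

Lemma BH_map_plus T x y : BH T -> T (plus x y) = plus (T x) (T y).
Proof. intros h; apply h. Qed.

Lemma BH_map_scal T (a : C) x : BH T -> T (scal a x) = scal a (T x).
Proof. intros h; apply h. Qed.

Lemma BH_map_zero T : BH T -> T zero = zero.
Proof.
  intros h. transitivity (T (scal (RtoC 0) zero)).
  - f_equal. module.
  - rewrite BH_map_scal by easy. module.
Qed.

Lemma BH_map_minus T x y : BH T -> T (minus x y) = minus (T x) (T y).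
Proof.
  intros h. transitivity (T (plus x (scal (RtoC (-1)) y))).
  - f_equal. module; apply injective_projections; cbn; ring.
  - rewrite BH_map_plus, BH_map_scal by easy.
    module; apply injective_projections; cbn; ring.
Qed.

Lemma BH_intro T (M : R) :
  (forall x y, T (plus x y) = plus (T x) (T y)) ->
  (forall (a : C) x, T (scal a x) = scal a (T x)) ->
  (forall x, norm (T x) <= M * norm x) -> BH T.
Proof.
  intros h1 h2 h3. split; [exact h1|exact h2|].
  exists (Rabs M + 1). split; [pose proof (Rabs_pos M); lra|].
  intros x. apply Rle_trans with (1 := h3 x). apply Rmult_le_compat_r.
  - apply norm_ge_0.
  - pose proof (Rle_abs M); lra.
Qed.

(** The set contains 0 and is bounded above, so its supremum in [Rbar] is finite and [real] returns
    it instead of a default value. *)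
Lemma opnorm_lub T : BH T ->
  is_lub_Rbar (fun r => exists x : H, norm x <= 1 /\ r = norm (T x)) (opnorm T).
Proof.
  intros [_ _ [M [hM hT]]]. unfold opnorm.
  set (E := fun r => _). pose proof (Lub_Rbar_correct E) as hl.
  assert (h0 : E 0).
  { exists zero. rewrite normH_zero. split; [lra|]. symmetry.
    apply Rle_antisym; [|apply norm_ge_0].
    apply Rle_trans with (1 := hT _). rewrite normH_zero. lra. }
  assert (hf : is_finite (Lub_Rbar E)).
  { apply is_finite_correct. destruct hl as [hub hle].
    destruct (Lub_Rbar E) as [r| |].
    - now exists r.
    - exfalso. apply (hle (Finite M)). intros r [x [hx ->]].
      apply Rle_trans with (1 := hT x). rewrite <- (Rmult_1_r M) at 2.
      apply Rmult_le_compat_l; [lra|easy].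
    - exfalso. apply (hub 0 h0). }
  rewrite <- hf in hl. exact hl.
Qed.

Lemma opnorm_ge0 T : BH T -> 0 <= opnorm T.
Proof.
  intros h. destruct (opnorm_lub T h) as [hub _].
  apply Rle_trans with (norm (T zero)); [apply norm_ge_0|].
  apply (hub (norm (T zero))). exists zero. rewrite normH_zero. split; [lra|easy].
Qed.

Lemma opnorm_bound T x : BH T -> norm (T x) <= opnorm T * norm x.
Proof.
  intros h. destruct (opnorm_lub T h) as [hub _].
  destruct (Req_dec (norm x) 0) as [h0|h0].
  - apply normH_eq0 in h0. subst x. rewrite BH_map_zero, normH_zero by easy.  lra.
  - pose proof (norm_ge_0 x) as h1. assert (hx : 0 < norm x) by lra.
    assert (hm : Cmod (RtoC (/ norm x)) = / norm x).
    { rewrite Cmod_R. apply Rabs_pos_eq. left. now apply Rinv_0_lt_compat. }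
    assert (hb : norm (T (scal (RtoC (/ norm x)) x)) <= opnorm T).
    { apply (hub (norm _)). eexists. split; [|reflexivity].
      rewrite normH_scal, hm. right. now field. }
    rewrite BH_map_scal, normH_scal, hm in hb by easy.
    apply Rmult_le_reg_l with (/ norm x); [now apply Rinv_0_lt_compat|].
    apply Rle_trans with (1 := hb). right. now field.
Qed.

Lemma opnorm_le T (M : R) : BH T ->
  (forall x, norm x <= 1 -> norm (T x) <= M) -> opnorm T <= M.
Proof.
  intros h hM. destruct (opnorm_lub T h) as [_ hle].
  apply (hle (Finite M)). intros r [x [hx ->]]. now apply hM.
Qed.

Lemma opnorm_le_linear T (M : R) : BH T -> 0 <= M ->
  (forall x, norm (T x) <= M * norm x) -> opnorm T <= M.
Proof.
  intros h h0 hM. apply opnorm_le; [easy|]. intros x hx.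
  apply Rle_trans with (1 := hM x). rewrite <- (Rmult_1_r M) at 2.
  now apply Rmult_le_compat_l.
Qed.

Lemma norm_plus_bounds x y (a b : R) :
  norm x <= a -> norm y <= b -> norm (plus x y) <= a + b.
Proof. intros h1 h2. apply Rle_trans with (1 := normH_triangle x y). lra. Qed.

Lemma BH_one : BH (op_one (H := H)).
Proof. apply BH_intro with 1; unfold op_one; intros; [easy|easy|lra]. Qed.

Lemma BH_plus S T : BH S -> BH T -> BH (op_plus S T).
Proof.
  intros hS hT. apply BH_intro with (opnorm S + opnorm T); unfold op_plus; intros.
  - rewrite !BH_map_plus by easy. module.
  - rewrite !BH_map_scal by easy. module.
  - apply Rle_trans with (1 := normH_triangle _ _).
    pose proof (opnorm_bound S x hS); pose proof (opnorm_bound T x hT). lra.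
Qed.

Lemma BH_scal (a : C) T : BH T -> BH (op_scal a T).
Proof.
  intros hT. apply BH_intro with (Cmod a * opnorm T); unfold op_scal; intros.
  - rewrite !BH_map_plus by easy. module.
  - rewrite !BH_map_scal by easy. module.
  - rewrite normH_scal, Rmult_assoc. apply Rmult_le_compat_l; [apply Cmod_ge_0|].
    now apply opnorm_bound.
Qed.

Lemma BH_mult S T : BH S -> BH T -> BH (op_mult S T).
Proof.
  intros hS hT. apply BH_intro with (opnorm S * opnorm T); unfold op_mult; intros.
  - now rewrite !BH_map_plus by easy.
  - now rewrite !BH_map_scal by easy.
  - apply Rle_trans with (1 := opnorm_bound S _ hS). rewrite Rmult_assoc.
    apply Rmult_le_compat_l; [now apply opnorm_ge0|]. now apply opnorm_bound.
Qed.

Lemma op_minus_plus S T : op_minus S T = op_plus S (op_scal (RtoC (-1)) T).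
Proof.
  apply functional_extensionality; intros x. unfold op_minus, op_plus, op_scal.
  module; apply injective_projections; cbn; ring.
Qed.

Lemma BH_minus S T : BH S -> BH T -> BH (op_minus S T).
Proof. intros hS hT. rewrite op_minus_plus. now apply BH_plus, BH_scal. Qed.

Lemma opnorm_plus S T : BH S -> BH T -> opnorm (op_plus S T) <= opnorm S + opnorm T.
Proof.
  intros hS hT. apply opnorm_le_linear.
  - now apply BH_plus.
  - pose proof (opnorm_ge0 S hS); pose proof (opnorm_ge0 T hT); lra.
  - intros x. rewrite Rmult_plus_distr_r. apply norm_plus_bounds; now apply opnorm_bound.
Qed.

Lemma opnorm_mult S T : BH S -> BH T -> opnorm (op_mult S T) <= opnorm S * opnorm T.
Proof.
  intros hS hT. apply opnorm_le_linear.
  - now apply BH_mult.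
  - apply Rmult_le_pos; now apply opnorm_ge0.
  - intros x. apply Rle_trans with (1 := opnorm_bound S _ hS). rewrite Rmult_assoc.
    apply Rmult_le_compat_l; [now apply opnorm_ge0|]. now apply opnorm_bound.
Qed.

Lemma opnorm_scal_le (a : C) T : BH T -> opnorm (op_scal a T) <= Cmod a * opnorm T.
Proof.
  intros hT. apply opnorm_le_linear.
  - now apply BH_scal.
  - apply Rmult_le_pos; [apply Cmod_ge_0|now apply opnorm_ge0].
  - intros x. unfold op_scal. rewrite normH_scal, Rmult_assoc.
    apply Rmult_le_compat_l; [apply Cmod_ge_0|]. now apply opnorm_bound.
Qed.

Lemma opnorm_scal (a : C) T : BH T -> opnorm (op_scal a T) = Cmod a * opnorm T.
Proof.
  intros hT. apply Rle_antisym; [now apply opnorm_scal_le|].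
  destruct (classic (a = RtoC 0)) as [->|ha].
  - rewrite Cmod_0, Rmult_0_l. apply opnorm_ge0. now apply BH_scal.
  - assert (ha' : 0 < Cmod a) by now apply Cmod_gt_0.
    pose proof (opnorm_scal_le (Cinv a) (op_scal a T) (BH_scal a T hT)) as h.
    replace (op_scal (Cinv a) (op_scal a T)) with T in h.
    + rewrite Cmod_inv in h by easy.
      apply Rmult_le_compat_l with (r := Cmod a) in h; [|lra].
      apply Rle_trans with (1 := h). right. field. lra.
    + apply functional_extensionality; intros x. unfold op_scal. module. now field.
Qed.

Lemma opnorm_eq0 T : BH T -> opnorm T = 0 -> T = (fun _ => zero).
Proof.
  intros hT h0. apply functional_extensionality; intros x. apply normH_eq0.
  apply Rle_antisym; [|apply norm_ge_0].
  apply Rle_trans with (1 := opnorm_bound T x hT). rewrite h0. lra.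
Qed.

Lemma normH_minus_sym x y : norm (minus x y) = norm (minus y x).
Proof.
  replace (minus x y) with (scal (RtoC (-1)) (minus y x)).
  - rewrite normH_scal, Cmod_R, Rabs_left; lra.
  - module; apply injective_projections; cbn; ring.
Qed.

(** Balls of the uniform structure and balls of the norm agree only up to [norm_factor], hence the
    rescaled radius. *)
Lemma Hilbert_complete (v : nat -> H) :
  (forall eps, 0 < eps -> exists N, forall n m, (N <= n)%nat -> (N <= m)%nat ->
     norm (minus (v n) (v m)) < eps) ->
  exists y : H, forall eps, 0 < eps ->
    exists N, forall n, (N <= n)%nat -> norm (minus (v n) y) < eps.
Proof.
  intros hc.
  assert (hl : exists y : H, filterlim v eventually (locally y)).
  { apply (filterlim_locally_cauchy (U := H)). intros eps.
    destruct (hc eps (cond_pos eps)) as [N hN].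
    exists (fun n => (N <= n)%nat). split.
    - now exists N.
    - intros n m hn hm. apply (norm_compat1 (V := H)). now apply hN. }
  destruct hl as [y hy]. exists y. intros eps heps.
  assert (hf : 0 < eps / (norm_factor (V := H))).
  { apply Rdiv_lt_0_compat; [easy|apply norm_factor_gt_0]. }
  destruct (proj1 (filterlim_locally (U := H) v y) hy (mkposreal _ hf)) as [N hN].
  exists N. intros n hn.
  assert (hb := norm_compat2 (V := H) _ _ _ (hN n hn)). cbn in hb.
  replace eps with (norm_factor (V := H) * (eps / norm_factor (V := H))); [easy|].
  field. pose proof (norm_factor_gt_0 (V := H)). lra.
Qed.

Lemma norm_le_eps (r a : R) : (forall eps, 0 < eps -> r <= a + eps) -> r <= a.
Proof.
  intros h. destruct (Rle_or_lt r a) as [|hlt]; [easy|].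
  specialize (h ((r - a) / 2) ltac:(lra)). lra.
Qed.

Lemma BH_complete (u : nat -> H -> H) :
  (forall n, BH (u n)) ->
  (forall eps : posreal, exists N : nat, forall n m : nat,
     (N <= n)%nat -> (N <= m)%nat -> opnorm (op_minus (u n) (u m)) < eps) ->
  exists T, BH T /\ is_lim_seq (fun n => opnorm (op_minus (u n) T)) 0.
Proof.
  intros hu hc.
  assert (hp : forall x, exists y : H, forall eps, 0 < eps ->
    exists N, forall n, (N <= n)%nat -> norm (minus (u n x) y) < eps).
  { intros x. apply Hilbert_complete. intros eps heps.
    assert (hx := norm_ge_0 x).
    assert (he : 0 < eps / (norm x + 1)) by (apply Rdiv_lt_0_compat; lra).
    destruct (hc (mkposreal _ he)) as [N hN]. exists N. intros n m hn hm.
    apply Rle_lt_trans with (opnorm (op_minus (u n) (u m)) * norm x).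
    - apply (opnorm_bound (op_minus (u n) (u m))). now apply BH_minus.
    - specialize (hN n m hn hm). cbn in hN.
      assert (hn0 := opnorm_ge0 _ (BH_minus _ _ (hu n) (hu m))).
      apply Rle_lt_trans with (opnorm (op_minus (u n) (u m)) * (norm x + 1)); [nra|].
      apply Rmult_lt_reg_r with (/ (norm x + 1)); [apply Rinv_0_lt_compat; lra|].
      rewrite Rmult_assoc, Rinv_r, Rmult_1_r by lra. exact hN. }
  destruct (choice _ hp) as [T hT].
  assert (hunif : forall eps, 0 < eps -> exists N, forall n, (N <= n)%nat ->
    forall x, norm (minus (u n x) (T x)) <= eps * norm x).
  { intros eps heps. destruct (hc (mkposreal _ heps)) as [N hN]. exists N.
    intros n hn x. apply norm_le_eps. intros e he.
    (* The index [N'] depends on [x], but it only serves to choose [m]; [N] does not, so the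
       estimate is uniform in [x]. *)
    destruct (hT x e he) as [N' hN'].
    set (m := Nat.max N N'). specialize (hN n m hn ltac:(lia)). cbn in hN.
    specialize (hN' m ltac:(lia)).
    replace (minus (u n x) (T x))
      with (plus (minus (u n x) (u m x)) (minus (u m x) (T x))) by module.
    apply norm_plus_bounds; [|lra].
    apply Rle_trans with (1 := opnorm_bound _ x (BH_minus _ _ (hu n) (hu m))).
    apply Rmult_le_compat_r; [apply norm_ge_0|lra]. }
  assert (hlin : forall a x b y, T (plus (scal a x) (scal b y))
    = plus (scal a (T x)) (scal b (T y))).
  { intros a x b y.
    set (d := minus (T (plus (scal a x) (scal b y))) (plus (scal a (T x)) (scal b (T y)))).
    assert (hd : norm d <= 0).
    { apply norm_le_eps. intros eps heps.
      set (K := norm (plus (scal a x) (scal b y)) + Cmod a * norm x + Cmod b * norm y + 1).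
      assert (hK : 0 < K).
      { unfold K. pose proof (norm_ge_0 (plus (scal a x) (scal b y))).
        pose proof (Rmult_le_pos _ _ (Cmod_ge_0 a) (norm_ge_0 x)).
        pose proof (Rmult_le_pos _ _ (Cmod_ge_0 b) (norm_ge_0 y)). lra. }
      destruct (hunif (eps / K)) as [N hN]; [now apply Rdiv_lt_0_compat|].
      specialize (hN N (le_n N)).
      replace d with (plus (minus (T (plus (scal a x) (scal b y))) (u N (plus (scal a x) (scal b y))))
        (plus (scal a (minus (u N x) (T x))) (scal b (minus (u N y) (T y))))).
      2:{ unfold d. rewrite (BH_map_plus (u N)), !(BH_map_scal (u N)) by apply hu. module. }
      rewrite Rplus_0_l.
      apply Rle_trans with (eps / K * norm (plus (scal a x) (scal b y))
        + (Cmod a * (eps / K * norm x) + Cmod b * (eps / K * norm y))).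
      - apply norm_plus_bounds; [rewrite normH_minus_sym; apply hN|].
        apply norm_plus_bounds; rewrite normH_scal;
          apply Rmult_le_compat_l; try apply Cmod_ge_0; apply hN.
      - apply Rle_trans with (eps / K * (K - 1)); [unfold K; lra|].
        assert (0 < eps / K) by now apply Rdiv_lt_0_compat.
        replace eps with (eps / K * K) at 2 by (field; lra). lra. }
    assert (h0 : norm d = 0) by (apply Rle_antisym; [easy|apply norm_ge_0]).
    apply normH_eq0 in h0.
    transitivity (plus d (plus (scal a (T x)) (scal b (T y)))).
    - unfold d. module.
    - rewrite h0. module. }
  assert (hBH : BH T).
  { destruct (hunif 1 ltac:(lra)) as [N hN]. specialize (hN N (le_n N)).
    apply BH_intro with (1 + opnorm (u N)).
    - intros x y. transitivity (T (plus (scal (RtoC 1) x) (scal (RtoC 1) y))).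
      + f_equal. module.
      + rewrite hlin. module.
    - intros a x. transitivity (T (plus (scal a x) (scal (RtoC 0) x))).
      + f_equal. module.
      + rewrite hlin. module.
    - intros x. replace (T x) with (plus (minus (T x) (u N x)) (u N x)) by module.
      rewrite Rmult_plus_distr_r. apply norm_plus_bounds.
      + rewrite normH_minus_sym. apply hN.
      + now apply opnorm_bound. }
  exists T. split; [easy|].
  apply is_lim_seq_spec. intros eps.
  assert (he : 0 < eps / 2) by (pose proof (cond_pos eps); lra).
  destruct (hunif _ he) as [N hN]. exists N. intros n hn.
  rewrite Rminus_0_r, Rabs_pos_eq by (apply opnorm_ge0; now apply BH_minus).
  apply Rle_lt_trans with (eps / 2); [|lra].
  apply opnorm_le_linear; [now apply BH_minus|lra|]. intros x. now apply hN.
Qed.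

(** As an instance, B(H) shares the Neumann series, the resolvent estimates and the grid with a
    general subalgebra. *)
Definition BH_algebra : BanachSubalgebra H :=
  {| carrier := BH;
     alg_norm := opnorm;
     carrier_BH := fun T h => h;
     carrier_one := BH_one;
     carrier_plus := BH_plus;
     carrier_scal := BH_scal;
     carrier_mult := BH_mult;
     alg_norm_ge0 := opnorm_ge0;
     alg_norm_eq0 := opnorm_eq0;
     alg_norm_plus := opnorm_plus;
     alg_norm_scal := opnorm_scal;
     alg_norm_mult := opnorm_mult;
     alg_complete := BH_complete |}.

End OperatorNorm.

(** * Banach subalgebras *)

Ltac bounded :=
  match goal with
  | |- BH ?T => first [ assumption | apply (carrier_BH _ T); assumption
                      | apply BH_one
                      | apply BH_minus; bounded | apply BH_plus; bounded
                      | apply BH_scal; bounded | apply BH_mult; bounded ]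
  end.

Ltac linear_step T hT :=
  match goal with
  | |- context [T (plus ?a ?b)] => rewrite (BH_map_plus T a b hT)
  | |- context [T (minus ?a ?b)] => rewrite (BH_map_minus T a b hT)
  | |- context [T (scal ?a ?b)] => rewrite (BH_map_scal T a b hT)
  | |- context [T zero] => rewrite (BH_map_zero T hT)
  end.

Ltac linear :=
  repeat match goal with
  | hT : BH ?T |- _ => linear_step T hT
  | hT : carrier ?alg ?T |- _ => linear_step T (carrier_BH alg T hT)
  end.

Ltac unfold_op := unfold op_minus, op_plus, op_scal, op_mult, op_one in *.

Ltac op_eq :=
  let x := fresh "x" in
  apply functional_extensionality; intros x; unfold_op; linear; module.

Section Algebra.
Context {H : HilbertSpace} (alg : BanachSubalgebra H).
Implicit Types (S T X Y Q : H -> H).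

Definition op_zero : H -> H := fun _ => zero.

Lemma alg_zero : alg op_zero.
Proof.
  replace op_zero with (op_scal (RtoC 0) (op_one (H := H))).
  - apply carrier_scal, carrier_one.
  - unfold op_zero. op_eq.
Qed.

Lemma alg_minus S T : alg S -> alg T -> alg (op_minus S T).
Proof.
  intros hS hT. rewrite op_minus_plus. now apply carrier_plus, carrier_scal.
Qed.

Lemma alg_norm_zero : alg_norm alg op_zero = 0.
Proof.
  replace op_zero with (op_scal (RtoC 0) (op_one (H := H))).
  - rewrite alg_norm_scal by apply carrier_one. rewrite Cmod_0. ring.
  - unfold op_zero. op_eq.
Qed.

Lemma alg_norm_minus S T : alg S -> alg T ->
  alg_norm alg (op_minus S T) <= alg_norm alg S + alg_norm alg T.
Proof.
  intros hS hT. rewrite op_minus_plus.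
  apply Rle_trans with (1 := alg_norm_plus alg S _ hS (carrier_scal alg (RtoC (-1)) T hT)).
  rewrite alg_norm_scal, Cmod_R, Rabs_left by (easy || lra). lra.
Qed.

Lemma alg_norm_minus_sym S T : alg S -> alg T ->
  alg_norm alg (op_minus S T) = alg_norm alg (op_minus T S).
Proof.
  intros hS hT. replace (op_minus S T) with (op_scal (RtoC (-1)) (op_minus T S)).
  - rewrite alg_norm_scal, Cmod_R, Rabs_left by (lra || now apply alg_minus). lra.
  - apply functional_extensionality; intros x; unfold_op. module;
    apply injective_projections; cbn; ring.
Qed.

Lemma op_minus_eq0 S T : op_minus S T = op_zero -> S = T.
Proof.
  intros h. apply functional_extensionality; intros x.
  assert (hx : minus (S x) (T x) = zero) by exact (f_equal (fun U => U x) h).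
  transitivity (plus (minus (S x) (T x)) (T x)); [module|]. rewrite hx. module.
Qed.

Lemma alg_eq_of_small S T : alg S -> alg T ->
  (forall eps, 0 < eps -> alg_norm alg (op_minus S T) <= eps) -> S = T.
Proof.
  intros hS hT h. apply op_minus_eq0. apply (alg_norm_eq0 alg); [now apply alg_minus|].
  apply Rle_antisym; [|apply alg_norm_ge0; now apply alg_minus].
  apply norm_le_eps. intros eps heps. rewrite Rplus_0_l. now apply h.
Qed.

Fixpoint op_sum (n : nat) (u : nat -> H -> H) : H -> H :=
  match n with
  | O => op_zero
  | S n => op_plus (op_sum n u) (u n)
  end.

Lemma alg_sum n u : (forall k, (k < n)%nat -> alg (u k)) -> alg (op_sum n u).
Proof.
  intros hu. induction n as [|n IH]; cbn; [apply alg_zero|].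
  apply carrier_plus; [apply IH; intros; apply hu; lia|apply hu; lia].
Qed.

Lemma alg_norm_sum n u (c : R) :
  (forall k, (k < n)%nat -> alg (u k) /\ alg_norm alg (u k) <= c) ->
  alg_norm alg (op_sum n u) <= INR n * c.
Proof.
  intros hu. induction n as [|n IH]; [cbn; rewrite alg_norm_zero; lra|].
  rewrite S_INR. cbn [op_sum].
  apply Rle_trans with (alg_norm alg (op_sum n u) + alg_norm alg (u n)).
  - apply alg_norm_plus; [apply alg_sum; intros; apply hu; lia|apply hu; lia].
  - assert (alg_norm alg (op_sum n u) <= INR n * c) by (apply IH; intros; apply hu; lia).
    assert (alg_norm alg (u n) <= c) by (apply hu; lia). lra.
Qed.

Lemma alg_series (u : nat -> H -> H) (c : R) :
  0 <= c -> (forall n, alg (u n)) -> (forall n, alg_norm alg (u n) <= c * (/ 2) ^ n) ->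
  exists T, alg T /\ alg_norm alg T <= 2 * c /\
    forall n, alg_norm alg (op_minus T (op_sum n u)) <= 2 * c * (/ 2) ^ n.
Proof.
  intros hc hu hb.
  assert (hs : forall n, alg (op_sum n u)) by (intros; now apply alg_sum).
  (* The factor [1 - (/ 2) ^ k] is the exact geometric sum, which lets the induction on [k]
     close. *)
  assert (ht : forall n k,
    alg_norm alg (op_minus (op_sum (k + n) u) (op_sum n u)) <= 2 * c * (/ 2) ^ n * (1 - (/ 2) ^ k)).
  { intros n k. induction k as [|k IH].
    - replace (op_minus _ _) with op_zero by (cbn; unfold op_zero; op_eq).
      rewrite alg_norm_zero. cbn. lra.
    - replace (op_minus (op_sum (S k + n) u) (op_sum n u))
        with (op_plus (op_minus (op_sum (k + n) u) (op_sum n u)) (u (k + n)%nat))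
        by (cbn [op_sum Nat.add]; op_eq).
      apply Rle_trans with (1 := alg_norm_plus alg _ _ (alg_minus _ _ (hs _) (hs _)) (hu _)).
      specialize (hb (k + n)%nat). rewrite pow_add in hb. cbn [pow].
      replace (c * ((/ 2) ^ k * (/ 2) ^ n)) with (c * (/ 2) ^ n * (/ 2) ^ k) in hb by ring.
      lra. }
  assert (hp : forall n, 0 < (/ 2) ^ n) by (intros; apply pow_lt; lra).
  assert (ht' : forall n m, (n <= m)%nat ->
    alg_norm alg (op_minus (op_sum m u) (op_sum n u)) <= 2 * c * (/ 2) ^ n).
  { intros n m hnm. replace m with ((m - n) + n)%nat by lia.
    apply Rle_trans with (1 := ht n (m - n)%nat).
    pose proof (hp (m - n)%nat). pose proof (hp n).
    assert (0 <= 2 * c * (/ 2) ^ n) by nra. nra. }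
  assert (hz : forall eps, 0 < eps -> exists N, forall n, (N <= n)%nat -> 2 * c * (/ 2) ^ n < eps).
  { intros eps heps.
    destruct (pow_lt_1_zero (/ 2) ltac:(rewrite Rabs_pos_eq; lra) (eps / (2 * c + 1)))
      as [N hN]; [apply Rdiv_lt_0_compat; lra|].
    exists N. intros n hn. specialize (hN n hn).
    rewrite Rabs_pos_eq in hN by (left; apply hp).
    apply Rle_lt_trans with ((2 * c + 1) * (/ 2) ^ n); [pose proof (hp n); nra|].
    apply Rmult_lt_compat_l with (r := 2 * c + 1) in hN; [|lra].
    replace ((2 * c + 1) * (eps / (2 * c + 1))) with eps in hN by (field; lra). easy. }
  destruct (alg_complete alg (fun n => op_sum n u) hs) as [T [hT hl]].
  { intros eps. destruct (hz eps (cond_pos eps)) as [N hN]. exists N. intros n m hn hm.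
    destruct (Nat.le_ge_cases n m) as [h|h].
    - rewrite alg_norm_minus_sym by apply hs.
      apply Rle_lt_trans with (1 := ht' n m h). now apply hN.
    - apply Rle_lt_trans with (1 := ht' m n h). now apply hN. }
  assert (hlim : forall n, alg_norm alg (op_minus T (op_sum n u)) <= 2 * c * (/ 2) ^ n).
  { intros n. apply norm_le_eps. intros eps heps.
    apply is_lim_seq_spec in hl. destruct (hl (mkposreal _ heps)) as [N hN].
    set (m := Nat.max n N). specialize (hN m ltac:(unfold m; lia)). cbn in hN.
    rewrite Rminus_0_r in hN. apply Rabs_def2 in hN.
    replace (op_minus T (op_sum n u))
      with (op_minus (op_minus (op_sum m u) (op_sum n u)) (op_minus (op_sum m u) T)) by op_eq.
    apply Rle_trans with (1 := alg_norm_minus _ _ (alg_minus _ _ (hs _) (hs _)) (alg_minus _ _ (hs _) hT)).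
    pose proof (ht' n m ltac:(unfold m; lia)). lra. }
  exists T. split; [easy|]. split; [|easy].
  specialize (hlim O). cbn in hlim.
  replace (op_minus T op_zero) with T in hlim by (unfold op_zero; op_eq). lra.
Qed.

(* Successive approximation, as in the proof of the open mapping theorem. *)
Lemma alg_solve_of_approx (L : (H -> H) -> H -> H) (M K : R) :
  0 <= M -> 0 <= K ->
  (forall X, alg X -> alg (L X)) ->
  (forall X Y, alg X -> alg Y -> L (op_plus X Y) = op_plus (L X) (L Y)) ->
  (forall X Y, alg X -> alg Y -> L (op_minus X Y) = op_minus (L X) (L Y)) ->
  (forall X, alg X -> alg_norm alg (L X) <= M * alg_norm alg X) ->
  (forall Q, alg Q -> exists X, alg X /\ alg_norm alg X <= K * alg_norm alg Q /\
     alg_norm alg (op_minus Q (L X)) <= / 2 * alg_norm alg Q) ->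
  forall Q, alg Q -> exists X, alg X /\ alg_norm alg X <= 2 * K * alg_norm alg Q /\ L X = Q.
Proof.
  intros hM hK hL hplus hminus hLM happ Q hQ.
  (* The membership of [P] is moved under the existential so that [choice] yields a total map;
     outside the algebra its value is arbitrary. *)
  assert (hch : forall P, exists X, alg P -> alg X /\ alg_norm alg X <= K * alg_norm alg P /\
     alg_norm alg (op_minus P (L X)) <= / 2 * alg_norm alg P).
  { intros P. destruct (classic (alg P)) as [h|h].
    - destruct (happ P h) as [X hX]. now exists X.
    - now exists P. }
  destruct (choice _ hch) as [F hF].
  set (q := fix q n := match n with O => Q | S n => op_minus (q n) (L (F (q n))) end).
  assert (hq : forall n, alg (q n) /\ alg_norm alg (q n) <= alg_norm alg Q * (/ 2) ^ n).
  { induction n as [|n [IH1 IH2]]; cbn [q pow].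
    - split; [easy|lra].
    - destruct (hF _ IH1) as [h1 [h2 h3]]. split.
      + apply alg_minus; [easy|]. now apply hL.
      + lra. }
  pose proof (alg_norm_ge0 alg Q hQ) as hQ0.
  destruct (alg_series (fun n => F (q n)) (K * alg_norm alg Q)) as [X [hX [hXn hXl]]].
  - now apply Rmult_le_pos.
  - intros n. now apply hF, hq.
  - intros n. destruct (hq n) as [h1 h2]. destruct (hF _ h1) as [_ [h3 _]].
    apply Rle_trans with (1 := h3). rewrite Rmult_assoc. now apply Rmult_le_compat_l.
  - assert (hs : forall n, alg (op_sum n (fun n => F (q n)))).
    { intros n. apply alg_sum. intros k _. now apply hF, hq. }
    assert (hLs : forall n, L (op_sum n (fun n => F (q n))) = op_minus Q (q n)).
    { induction n as [|n IH]; cbn [op_sum].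
      - replace op_zero with (op_minus op_zero op_zero) by (unfold op_zero; op_eq).
        rewrite hminus by apply alg_zero. cbn. op_eq.
      - rewrite hplus, IH by (apply hs || now apply hF, hq). cbn [q]. op_eq. }
    exists X. split; [easy|]. split; [lra|].
    apply alg_eq_of_small; [now apply hL|easy|].
    intros eps heps.
    set (C := M * (2 * (K * alg_norm alg Q)) + alg_norm alg Q + 1).
    assert (hC : 0 < C).
    { unfold C. assert (0 <= K * alg_norm alg Q) by now apply Rmult_le_pos.
      assert (0 <= M * (2 * (K * alg_norm alg Q))) by (apply Rmult_le_pos; lra). lra. }
    destruct (pow_lt_1_zero (/ 2) ltac:(rewrite Rabs_pos_eq; lra) (eps / C))
      as [N hN]; [now apply Rdiv_lt_0_compat|].
    specialize (hN N (le_n N)).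
    assert (hp : 0 < (/ 2) ^ N) by (apply pow_lt; lra).
    rewrite Rabs_pos_eq in hN by lra.
    replace (op_minus (L X) Q)
      with (op_minus (L (op_minus X (op_sum N (fun n => F (q n))))) (q N)).
    2:{ rewrite hminus, hLs by easy. op_eq. }
    apply Rle_trans with (M * (2 * (K * alg_norm alg Q) * (/ 2) ^ N) + alg_norm alg Q * (/ 2) ^ N).
    + assert (hXs : alg (op_minus X (op_sum N (fun n => F (q n))))) by now apply alg_minus.
      apply Rle_trans with (1 := alg_norm_minus _ _ (hL _ hXs) (proj1 (hq N))).
      apply Rplus_le_compat; [|apply hq].
      apply Rle_trans with (1 := hLM _ hXs). apply Rmult_le_compat_l; [easy|]. apply hXl.
    + apply Rle_trans with (C * (/ 2) ^ N); [unfold C; lra|].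
      apply Rmult_lt_compat_l with (r := C) in hN; [|easy].
      replace (C * (eps / C)) with eps in hN by (field; lra). lra.
Qed.

Lemma inverse_unique T S S' : is_inverse T S -> is_inverse T S' -> S = S'.
Proof.
  intros [h1 h2] [h3 h4]. apply functional_extensionality; intros x.
  apply (f_equal (fun U => U x)) in h3. apply (f_equal (fun U => U (S' x))) in h2.
  unfold op_mult, op_one in *. now rewrite h3 in h2.
Qed.

(** The guess [X = Q] solves [(1 - E) X = Q] up to [E Q], and [X (1 - E) = Q] up to [Q E]; the two
    one-sided inverses then coincide. The norm of the identity is kept as a factor because the
    axioms do not set it to 1. *)
Lemma alg_neumann E : alg E -> alg_norm alg E <= / 2 ->
  exists V, alg V /\ alg_norm alg V <= 2 * alg_norm alg op_one /\ is_inverse (op_minus op_one E) V.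
Proof.
  intros hE hEn.
  assert (h1 := carrier_one alg).
  assert (hI : alg (op_minus op_one E)) by now apply alg_minus.
  assert (hI0 := alg_norm_ge0 alg _ hI).
  destruct (alg_solve_of_approx (fun X => op_mult (op_minus op_one E) X)
    (alg_norm alg (op_minus op_one E)) 1 hI0 Rle_0_1) with (Q := op_one (H := H))
    as [V [hV [hVn hV1]]]; try easy.
  - intros X hX. now apply carrier_mult.
  - intros X Y hX hY. op_eq.
  - intros X Y hX hY. op_eq.
  - intros X hX. now apply alg_norm_mult.
  - intros Q hQ. exists Q. split; [easy|]. split; [lra|].
    replace (op_minus Q _) with (op_mult E Q) by op_eq.
    apply Rle_trans with (1 := alg_norm_mult alg E Q hE hQ).
    apply Rmult_le_compat_r; [now apply alg_norm_ge0|easy].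
  - destruct (alg_solve_of_approx (fun X => op_mult X (op_minus op_one E))
      (alg_norm alg (op_minus op_one E)) 1 hI0 Rle_0_1) with (Q := op_one (H := H))
      as [W [hW [hWn hW1]]]; try easy.
    + intros X hX. now apply carrier_mult.
    + intros X hX. rewrite Rmult_comm. now apply alg_norm_mult.
    + intros Q hQ. exists Q. split; [easy|]. split; [lra|].
      replace (op_minus Q _) with (op_mult Q E) by op_eq.
      apply Rle_trans with (1 := alg_norm_mult alg Q E hQ hE). rewrite Rmult_comm.
      apply Rmult_le_compat_r; [now apply alg_norm_ge0|easy].
    + exists V. split; [easy|]. split; [lra|]. split; [easy|].
      assert (E1 : W = V); [|congruence].
      apply functional_extensionality; intros x.
      apply (f_equal (fun U => W (U x))) in hV1.
      apply (f_equal (fun U => U (V x))) in hW1.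
      unfold_op. congruence.
Qed.

End Algebra.

(** * Resolvents and normal operators *)

Section Resolvent.
Context {H : HilbertSpace} (alg : BanachSubalgebra H).
Implicit Types (S T V W X Y : H -> H) (z w u : C).

Definition op_shift T z : H -> H := op_minus T (op_scal z op_one).

Lemma alg_shift T z : alg T -> alg (op_shift T z).
Proof. intros hT. apply alg_minus; [easy|]. apply carrier_scal, carrier_one. Qed.

Lemma inverse_app T S x : is_inverse T S -> T (S x) = x.
Proof. intros [h _]. exact (f_equal (fun U => U x) h). Qed.

Lemma inverse_app' T S x : is_inverse T S -> S (T x) = x.
Proof. intros [_ h]. exact (f_equal (fun U => U x) h). Qed.

Lemma shift_inverse_app T S z x : is_inverse (op_shift T z) S -> T (S x) = plus x (scal z (S x)).
Proof.
  intros h. pose proof (inverse_app _ _ x h) as hx. unfold op_shift in hx. unfold_op.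
  transitivity (plus (minus (T (S x)) (scal z (S x))) (scal z (S x))); [module|].
  rewrite hx. module.
Qed.

Lemma shift_inverse_app' T S z x : BH S -> is_inverse (op_shift T z) S ->
  S (T x) = plus x (scal z (S x)).
Proof.
  intros hS h. pose proof (inverse_app' _ _ x h) as hx. unfold op_shift in hx. unfold_op.
  rewrite BH_map_minus, BH_map_scal in hx by easy.
  transitivity (plus (minus (S (T x)) (scal z (S x))) (scal z (S x))); [module|].
  rewrite hx. module.
Qed.

(** From the factorisation [T - w = (T - z) (1 - (w - z) S)], whose second factor is inverted by
    [alg_neumann]. *)
Lemma resolvent_perturbation T S z w :
  alg T -> alg S -> is_inverse (op_shift T z) S ->
  Cmod (Cminus w z) * alg_norm alg S <= / 2 ->
  exists V, alg V /\ is_inverse (op_shift T w) V /\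
    alg_norm alg V <= 2 * alg_norm alg op_one * alg_norm alg S.
Proof.
  intros hT hS hi hsmall.
  destruct (alg_neumann alg (op_scal (Cminus w z) S)) as [U [hU [hUn hUi]]].
  - now apply carrier_scal.
  - now rewrite alg_norm_scal.
  - exists (op_mult U S). split; [now apply carrier_mult|]. split; [split|].
    + apply functional_extensionality; intros x.
      transitivity (op_shift T z (op_minus op_one (op_scal (Cminus w z) S) (U (S x)))).
      * unfold op_shift; unfold_op; linear. rewrite (shift_inverse_app T S z _ hi).
        module.
      * rewrite (inverse_app _ _ _ hUi). now apply inverse_app.
    + apply functional_extensionality; intros x.
      transitivity (U (op_minus op_one (op_scal (Cminus w z) S) x)).
      * unfold op_shift; unfold_op; linear.
        rewrite (shift_inverse_app' T S z _ (carrier_BH alg S hS) hi). linear. module.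
      * now apply inverse_app'.
    + apply Rle_trans with (1 := alg_norm_mult alg U S hU hS).
      apply Rmult_le_compat_r; [now apply alg_norm_ge0|easy].
Qed.

(** From [T - z = - z (1 - T / z)]. The threshold is twice the norm because [alg_neumann] works with
    ratio 1/2. *)
Lemma resolvent_large T z :
  alg T -> z <> RtoC 0 -> 2 * alg_norm alg T <= Cmod z ->
  exists V, alg V /\ is_inverse (op_shift T z) V /\
    alg_norm alg V <= 2 * alg_norm alg op_one / Cmod z.
Proof.
  intros hT hz hl.
  assert (hz' : 0 < Cmod z) by now apply Cmod_gt_0.
  destruct (alg_neumann alg (op_scal (Cinv z) T)) as [U [hU [hUn hUi]]].
  - now apply carrier_scal.
  - rewrite alg_norm_scal, Cmod_inv by easy.
    apply Rmult_le_reg_l with (Cmod z); [easy|].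
    rewrite <- Rmult_assoc, Rinv_r by lra. lra.
  - exists (op_scal (Copp (Cinv z)) U). split; [now apply carrier_scal|]. split; [split|].
    + apply functional_extensionality; intros x.
      transitivity (op_minus op_one (op_scal (Cinv z) T) (U x)).
      * unfold op_shift; unfold_op; linear. module; now field.
      * now apply inverse_app.
    + apply functional_extensionality; intros x.
      transitivity (U (op_minus op_one (op_scal (Cinv z) T) x)).
      * unfold op_shift; unfold_op; linear. module; now field.
      * now apply inverse_app'.
    + rewrite alg_norm_scal, Cmod_opp, Cmod_inv by easy.
      unfold Rdiv. rewrite Rmult_comm. apply Rmult_le_compat_r; [|easy].
      left; now apply Rinv_0_lt_compat.
Qed.

Lemma resolvent_identity T V W u w : BH V -> BH W ->
  is_inverse (op_shift T u) V -> is_inverse (op_shift T w) W ->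
  op_minus V W = op_scal (Cminus u w) (op_mult V W).
Proof.
  intros hV hW h1 h2. apply functional_extensionality; intros x.
  pose proof (shift_inverse_app T W w x h2) as e1.
  pose proof (shift_inverse_app' T V u (W x) hV h1) as e2.
  rewrite e1 in e2. unfold_op. rewrite BH_map_plus, BH_map_scal in e2 by easy.
  transitivity (minus (minus (plus (V x) (scal w (V (W x)))) (scal w (V (W x)))) (W x));
    [module|].
  rewrite e2. module.
Qed.

End Resolvent.

(** * Uniform constants on a disc by compactness *)

Section Gauge.

Lemma Cmod_le_components (z : C) : Cmod z <= Rabs (fst z) + Rabs (snd z).
Proof.
  replace z with (Cplus (RtoC (fst z)) (Cmult Ci (RtoC (snd z)))) at 1.
  - apply Rle_trans with (1 := Cmod_triangle _ _).
    rewrite Cmod_mult, Cmod_Ci, !Cmod_R. lra.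
  - destruct z as [a b]. apply injective_projections; cbn; ring.
Qed.

Lemma fst_le_Cmod (z : C) : Rabs (fst z) <= Cmod z.
Proof. exact (Rle_trans _ _ _ (Rmax_l _ _) (Rmax_Cmod z)). Qed.

Lemma snd_le_Cmod (z : C) : Rabs (snd z) <= Cmod z.
Proof. exact (Rle_trans _ _ _ (Rmax_r _ _) (Rmax_Cmod z)). Qed.

(** A Lebesgue number argument that turns constants chosen point by point into a uniform one: [d] is
    below the radii of a family of discs that covers. *)
Lemma disc_gauge (a : R) (g : C -> R) : (forall p, 0 < g p) ->
  exists d, 0 < d /\ forall z : C, Cmod z <= a ->
    exists p, Cmod (Cminus z p) < g p /\ d <= g p.
Proof.
  intros hg.
  (* The compactness result controls each coordinate separately; halving the gauge absorbs
     [|z| <= |Re z| + |Im z|]. *)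
  assert (hg2 : forall u v, 0 < g (u, v) / 2) by (intros u v; specialize (hg (u, v)); lra).
  destruct (compactness_value_2d (- a) a (- a) a (fun u v => mkposreal _ (hg2 u v)))
    as [d hd].
  exists d. split; [apply cond_pos|]. intros z hz.
  pose proof (fst_le_Cmod z) as h1. pose proof (snd_le_Cmod z) as h2.
  destruct (NNPP _ (hd (fst z) (snd z) ltac:(apply Rabs_le_between; lra)
    ltac:(apply Rabs_le_between; lra))) as [u [v [_ [_ [h3 [h4 h5]]]]]].
  cbn in h3, h4, h5. exists (u, v). specialize (hg (u, v)). split; [|lra].
  apply Rle_lt_trans with (1 := Cmod_le_components _). cbn in *.
  unfold Rminus in *. lra.
Qed.

End Gauge.

(** * Norm inequalities for normal operators *)

Section Normal.
Context {H : HilbertSpace}.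
Implicit Types (x y z : H) (N M S T : H -> H).

Lemma inner_plus_r x y z : inner x (plus y z) = Cplus (inner x y) (inner x z).
Proof. rewrite inner_conj, inner_plus, Cplus_conj, <- !inner_conj. easy. Qed.

Lemma inner_scal_r (a : C) x y : inner x (scal a y) = Cmult (Cconj a) (inner x y).
Proof. rewrite inner_conj, inner_scal, Cmult_conj, <- inner_conj. easy. Qed.

Lemma cauchy_schwarz x y : Cmod (inner x y) <= norm x * norm y.
Proof.
  pose proof (norm_ge_0 x) as hx. pose proof (norm_ge_0 y) as hy.
  set (c := inner x y).
  assert (hyx : inner y x = Cconj c) by apply inner_conj.
  (* The component of [x] orthogonal to [y], multiplied by [|y|^2] to clear the denominator. *)
  set (v := plus (scal (RtoC (norm y ^ 2)) x) (scal (Copp c) y)).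
  assert (hv : inner v v = RtoC (norm y ^ 2 * (norm y ^ 2 * norm x ^ 2 - Cmod c ^ 2))).
  { unfold v.
    rewrite inner_plus, !inner_plus_r, !inner_scal, !inner_scal_r, !inner_norm, hyx.
    fold c. rewrite Copp_conj.
    replace (Cconj (RtoC (norm y ^ 2))) with (RtoC (norm y ^ 2))
      by (apply injective_projections; cbn; ring).
    transitivity (Cmult (RtoC (norm y ^ 2))
      (Cminus (Cmult (RtoC (norm y ^ 2)) (RtoC (norm x ^ 2))) (Cmult c (Cconj c)))).
    - ring.
    - rewrite <- Cmod2_conj. apply injective_projections; cbn; ring. }
  rewrite inner_norm in hv. apply (f_equal fst) in hv. cbn [fst RtoC] in hv.
  destruct (Req_dec (norm y) 0) as [h0|h0].
  - assert (hy0 : y = zero) by now apply normH_eq0.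
    replace c with (RtoC 0); [rewrite Cmod_0; nra|].
    unfold c. rewrite hy0. replace (zero : H) with (scal (RtoC 0) (zero : H)) by module.
    rewrite inner_scal_r. apply injective_projections; cbn; ring.
  - pose proof (norm_ge_0 v) as hv0.
    assert (hp : 0 < norm y ^ 2) by nra.
    assert (h1 : 0 <= norm y ^ 2 * norm x ^ 2 - Cmod c ^ 2).
    { destruct (Rle_or_lt 0 (norm y ^ 2 * norm x ^ 2 - Cmod c ^ 2)); [easy|nra]. }
    pose proof (Cmod_ge_0 c). apply Rsqr_incr_0_var; unfold Rsqr; nra.
Qed.

(** With [M] the adjoint, [|N x|^2] is the inner product of [x] and [M N x], and commutation gives
    [|M v| = |N v|] for all [v]. This is paranormality, the only trace of normality that the
    resolvent bound uses. *)
Lemma norm_normal_le N M x :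
  (forall x y, inner (N x) y = inner x (M y)) -> op_mult M N = op_mult N M ->
  norm (N x) ^ 2 <= norm x * norm (N (N x)).
Proof.
  intros hadj hcomm.
  assert (hn : forall v, norm (M v) = norm (N v)).
  { intros v.
    assert (h : RtoC (norm (M v) ^ 2) = RtoC (norm (N v) ^ 2)).
    { rewrite <- !inner_norm, <- hadj.
      replace (N (M v)) with (M (N v)) by exact (f_equal (fun U => U v) hcomm).
      rewrite inner_conj, <- hadj, inner_norm. apply injective_projections; cbn; ring. }
    apply (f_equal fst) in h. cbn [fst RtoC] in h.
    pose proof (norm_ge_0 (M v)); pose proof (norm_ge_0 (N v)).
    apply Rsqr_inj; [easy|easy|]. unfold Rsqr. lra. }
  rewrite <- (hn (N x)).
  apply Rle_trans with (2 := cauchy_schwarz x (M (N x))).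
  rewrite <- hadj, inner_norm, Cmod_R. apply Rle_abs.
Qed.

Lemma norm_normal_shift_le T (w : C) x : BH T -> normal T ->
  norm (op_shift T w x) ^ 2 <= norm x * norm (op_shift T w (op_shift T w x)).
Proof.
  intros hT [S [[hS hadj] hcomm]].
  apply norm_normal_le with (op_shift S (Cconj w)).
  - intros a b. unfold op_shift. rewrite !op_minus_plus. unfold op_plus, op_scal, op_one.
    rewrite inner_plus, inner_plus_r, !inner_scal, !inner_scal_r, hadj, Cconj_conj.
    f_equal. apply injective_projections; cbn; ring.
  - apply functional_extensionality; intros a.
    assert (h : S (T a) = T (S a)) by exact (f_equal (fun U => U a) hcomm).
    unfold op_shift; unfold_op; linear. rewrite h. module.
Qed.

End Normal.

(** * The resolvent of a normal operator *)

Section ResolventBound.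
Context {H : HilbertSpace}.
Implicit Types (x y : H) (N S T V W : H -> H) (z w u p : C).

(** The gauge [g] has two roles, radius of validity and inverse of the bound on the resolvents, so a
    lower bound for [g] on a cover is an upper bound for the resolvents. *)
Lemma resolvent_bounded_on_disc N (r delta : R) :
  BH N -> r < delta ->
  (forall u, Cmod u < delta -> invertible_in BH (op_shift N u)) ->
  exists M, 0 <= M /\ forall u R, Cmod u <= r -> BH R -> is_inverse (op_shift N u) R ->
    opnorm R <= M.
Proof.
  intros hN hr hinv.
  set (e := opnorm (op_one (H := H))).
  assert (he : 0 <= e) by apply opnorm_ge0, BH_one.
  assert (hloc : forall p, exists g, 0 < g /\
    forall u R, Cmod u <= r -> BH R -> is_inverse (op_shift N u) R ->
      Cmod (Cminus u p) < g -> opnorm R <= / g).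
  { intros p. destruct (Rlt_or_le (Cmod p) delta) as [hp|hp].
    - destruct (hinv p hp) as [S [hS hSi]].
      pose proof (opnorm_ge0 S hS) as hS0.
      set (k := 2 * opnorm S + 2 * e * opnorm S + 1).
      assert (hk : 0 < k) by (unfold k; pose proof (Rmult_le_pos _ _ he hS0); lra).
      exists (/ k). split; [now apply Rinv_0_lt_compat|].
      intros u R hu hR hRi hup.
      destruct (resolvent_perturbation BH_algebra N S p u hN hS hSi) as [V [hV [hVi hVn]]].
      + cbn. apply Rle_trans with (/ k * opnorm S); [apply Rmult_le_compat_r; lra|].
        apply Rmult_le_reg_l with k; [easy|].
        rewrite <- Rmult_assoc, Rinv_r, Rmult_1_l by lra.
        unfold k. pose proof (Rmult_le_pos _ _ he hS0). lra.
      + rewrite (inverse_unique _ _ _ hRi hVi). rewrite Rinv_inv.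
        apply Rle_trans with (1 := hVn). cbn. fold e. unfold k. lra.
    (* A centre outside the disc of radius [delta] is harmless: no point of the disc of radius [r]
       is within [delta - r] of it. *)
    - exists (delta - r). split; [lra|]. intros u R hu _ _ hup. exfalso.
      pose proof (Cmod_triangle (Cminus p u) u) as ht.
      replace (Cplus (Cminus p u) u) with p in ht by ring.
      replace (Cminus p u) with (Copp (Cminus u p)) in ht by ring.
      rewrite Cmod_opp in ht. lra. }
  destruct (choice _ hloc) as [g hg].
  destruct (disc_gauge r g (fun p => proj1 (hg p))) as [d [hd hcov]].
  exists (/ d). split; [left; now apply Rinv_0_lt_compat|].
  intros u R hu hR hRi. destruct (hcov u hu) as [p [h1 h2]].
  apply Rle_trans with (/ g p); [now apply (proj2 (hg p) u)|].
  now apply Rinv_le_contravar.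
Qed.

Lemma de_moivre (t : R) (n : nat) :
  Cpow (cos t, sin t) n = (cos (INR n * t), sin (INR n * t)).
Proof.
  induction n as [|n IH].
  - cbn. rewrite Rmult_0_l, cos_0, sin_0. easy.
  - rewrite S_INR. replace ((INR n + 1) * t) with (t + INR n * t) by ring.
    rewrite cos_plus, sin_plus. cbn [Cpow]. rewrite IH.
    apply injective_projections; cbn; ring.
Qed.

(** Supplies the rotation of [u] under which [u ^ n] changes sign. *)
Lemma root_of_minus_one (n : nat) : (0 < n)%nat ->
  exists z, Cmod z = 1 /\ Cpow z n = RtoC (-1).
Proof.
  intros hn. exists (cos (PI / INR n), sin (PI / INR n)). split.
  - unfold Cmod; cbn [fst snd].
    replace (cos (PI / INR n) ^ 2 + sin (PI / INR n) ^ 2) with 1; [apply sqrt_1|].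
    pose proof (sin2_cos2 (PI / INR n)) as h. unfold Rsqr in h. lra.
  - rewrite de_moivre. replace (INR n * (PI / INR n)) with PI.
    + rewrite cos_PI, sin_PI. easy.
    + field. apply not_0_INR. lia.
Qed.

Definition op_pow (n : nat) T : H -> H := fun x => Nat.iter n T x.

Lemma op_pow_add m n T x : op_pow (m + n) T x = op_pow m T (op_pow n T x).
Proof. apply Nat.iter_add. Qed.

Lemma BH_pow n T : BH T -> BH (op_pow n T).
Proof. intros hT. induction n as [|n IH]; [apply BH_one|now apply (BH_mult T)]. Qed.

Lemma norm_op_pow n T x : BH T -> norm (op_pow n T x) <= opnorm T ^ n * norm x.
Proof.
  intros hT. induction n as [|n IH]; cbn [pow].
  - cbn. lra.
  - cbn. rewrite Rmult_assoc. apply Rle_trans with (1 := opnorm_bound T _ hT).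
    apply Rmult_le_compat_l; [now apply opnorm_ge0|easy].
Qed.

(* The norms of the iterates of [x] under [S] are logarithmically convex. *)
Lemma norm_op_pow_ge n S x :
  (forall y, norm (S y) ^ 2 <= norm y * norm (S (S y))) ->
  0 < norm (S x) -> norm x <= 1 -> (0 < n)%nat -> norm (S x) ^ n <= norm (op_pow n S x).
Proof.
  intros hpar hp hx hn. destruct n as [|n]; [lia|]. clear hn.
  set (p := norm (S x)) in *.
  assert (h : 0 < norm (op_pow n S x) /\
    p * norm (op_pow n S x) <= norm (op_pow (1 + n) S x) /\
    p ^ (1 + n) <= norm (op_pow (1 + n) S x)).
  { induction n as [|n [IH1 [IH2 IH3]]]; cbn [Nat.add] in *.
    - cbn. fold p. specialize (hpar x). pose proof (norm_ge_0 x) as hx0.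
      assert (norm x <> 0).
      { intros h0. rewrite h0 in hpar. fold p in hpar. nra. }
      repeat split; nra.
    - assert (h1 : 0 < norm (op_pow (Datatypes.S n) S x)) by nra.
      pose proof (hpar (op_pow n S x)) as h2.
      change (S (op_pow n S x)) with (op_pow (Datatypes.S n) S x) in h2.
      change (S (op_pow (Datatypes.S n) S x))
        with (op_pow (Datatypes.S (Datatypes.S n)) S x) in h2.
      set (a := norm (op_pow n S x)) in *.
      set (b := norm (op_pow (Datatypes.S n) S x)) in *.
      set (c := norm (op_pow (Datatypes.S (Datatypes.S n)) S x)) in *.
      assert (h3 : p * b <= c).
      { apply Rmult_le_reg_l with a; [easy|].
        apply Rle_trans with (b * b); [nra|]. nra. }
      repeat split; [easy|easy|].
      apply Rle_trans with (p * b); [|easy].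
      change (p ^ Datatypes.S (Datatypes.S n)) with (p * p ^ Datatypes.S n).
      apply Rmult_le_compat_l; lra. }
  apply h.
Qed.

(** Only arbitrarily large exponents are needed, and powers of two pass from one to the next by
    squaring. *)
Definition is_power_resolvent S (k : nat) u V : Prop :=
  BH V /\ is_inverse (op_minus op_one (op_scal (Cpow u (2 ^ k)) (op_pow (2 ^ k) S))) V.

Lemma average_inverse (B U1 U2 : H -> H) (a : C) : BH B -> BH U1 -> BH U2 ->
  is_inverse (op_minus op_one (op_scal a B)) U1 ->
  is_inverse (op_minus op_one (op_scal (Copp a) B)) U2 ->
  is_inverse (op_minus op_one (op_scal (Cmult a a) (op_mult B B)))
    (op_scal (RtoC (/ 2)) (op_plus U1 U2)).
Proof.
  intros hB hU1 hU2 hi1 hi2.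
  set (P1 := op_minus op_one (op_scal a B)) in *.
  set (P2 := op_minus op_one (op_scal (Copp a) B)) in *.
  split; apply functional_extensionality; intros x.
  - transitivity (scal (RtoC (/ 2)) (plus (P2 (P1 (U1 x))) (P1 (P2 (U2 x))))).
    + unfold P1, P2; unfold_op; linear. module.
    + rewrite (inverse_app P1 U1 x hi1), (inverse_app P2 U2 x hi2).
      unfold P1, P2; unfold_op; linear.
      module; apply injective_projections; cbn; field.
  - transitivity (scal (RtoC (/ 2)) (plus (U1 (P1 (P2 x))) (U2 (P2 (P1 x))))).
    + unfold P1, P2; unfold_op; linear. module.
    + rewrite (inverse_app' P1 U1 _ hi1), (inverse_app' P2 U2 _ hi2).
      unfold P1, P2; unfold_op; linear.
      module; apply injective_projections; cbn; field.
Qed.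

(* By [(1 - a^2)^-1 = ((1 - a)^-1 + (1 + a)^-1) / 2], each family is the average
   of two rotated copies of the previous one, so the modulus of continuity of
   [k = 0] is inherited by all [k]. *)
Lemma power_resolvent_lipschitz S (r K : R) : BH S ->
  (forall u s, Cmod u <= r -> 0 <= s <= 1 -> exists V W,
     is_power_resolvent S 0 u V /\ is_power_resolvent S 0 (Cmult (RtoC s) u) W /\
     opnorm (op_minus V W) <= K * (1 - s)) ->
  forall k u s, Cmod u <= r -> 0 <= s <= 1 -> exists V W,
     is_power_resolvent S k u V /\ is_power_resolvent S k (Cmult (RtoC s) u) W /\
     opnorm (op_minus V W) <= K * (1 - s).
Proof.
  intros hS h0 k. induction k as [|k IH]; [easy|]. intros u s hu hs.
  set (n := (2 ^ k)%nat) in *.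
  assert (hn : (0 < n)%nat) by (unfold n; apply Nat.neq_0_lt_0, Nat.pow_nonzero; easy).
  destruct (root_of_minus_one n hn) as [z [hz1 hz2]].
  destruct (IH u s hu hs) as [V1 [W1 [hV1 [hW1 h1]]]].
  destruct (IH (Cmult z u) s) as [V2 [W2 [hV2 [hW2 h2]]]];
    [now rewrite Cmod_mult, hz1, Rmult_1_l|easy|].
  assert (hsq : forall t, Cpow t (2 ^ Datatypes.S k) = Cmult (Cpow t n) (Cpow t n)).
  { intros t. rewrite <- Cpow_add_r. f_equal. unfold n. cbn. lia. }
  assert (hSS : forall x, op_pow (2 ^ Datatypes.S k) S x = op_pow n S (op_pow n S x)).
  { intros x. rewrite <- op_pow_add. f_equal. unfold n. cbn. lia. }
  pose proof (BH_pow n S hS) as hB.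
  assert (hzn : forall t, Cpow (Cmult z t) n = Copp (Cpow t n)).
  { intros t. rewrite Cpow_mult_l, hz2. apply injective_projections; cbn; ring. }
  assert (havg : forall t U1 U2, is_power_resolvent S k t U1 ->
    is_power_resolvent S k (Cmult z t) U2 ->
    is_power_resolvent S (Datatypes.S k) t (op_scal (RtoC (/ 2)) (op_plus U1 U2))).
  { intros t U1 U2 [hU1 hi1] [hU2 hi2]. split; [bounded|]. fold n in hi1, hi2.
    rewrite hzn in hi2.
    replace (op_minus op_one (op_scal (Cpow t (2 ^ Datatypes.S k)) (op_pow (2 ^ Datatypes.S k) S)))
      with (op_minus op_one (op_scal (Cmult (Cpow t n) (Cpow t n))
             (op_mult (op_pow n S) (op_pow n S)))).
    - now apply average_inverse.
    - apply functional_extensionality; intros x. unfold_op. now rewrite hsq, hSS. }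
  exists (op_scal (RtoC (/ 2)) (op_plus V1 V2)), (op_scal (RtoC (/ 2)) (op_plus W1 W2)).
  split; [now apply havg|]. split.
  - apply havg; [easy|]. replace (Cmult z (Cmult (RtoC s) u)) with (Cmult (RtoC s) (Cmult z u))
      by ring. easy.
  - destruct hV1 as [hV1 _], hV2 as [hV2 _], hW1 as [hW1 _], hW2 as [hW2 _].
    replace (op_minus (op_scal (RtoC (/ 2)) (op_plus V1 V2)) (op_scal (RtoC (/ 2)) (op_plus W1 W2)))
      with (op_scal (RtoC (/ 2)) (op_plus (op_minus V1 W1) (op_minus V2 W2))) by op_eq.
    rewrite opnorm_scal, Cmod_R, Rabs_pos_eq by (lra || bounded).
    pose proof (opnorm_plus (op_minus V1 W1) (op_minus V2 W2) ltac:(bounded) ltac:(bounded)).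
    lra.
Qed.

(** If [q = opnorm S] exceeded [/ delta], the inverses of [1 - (u S)^n], for [n = 2^k], would exist
    on a disc reaching past the circle [|u| = / q], with one radial Lipschitz constant for all [n].
    Just inside the circle they approach 1 as [n] grows; just outside, the growth of [(u S)^n x]
    forced by paranormality keeps them away from 1. This does the work of analyticity in the
    spectral radius formula. *)
Lemma paranormal_inverse_bound N S (delta : R) :
  BH N -> BH S -> is_inverse N S -> 0 < delta ->
  (forall x, norm (N x) ^ 2 <= norm x * norm (N (N x))) ->
  (forall u, Cmod u < delta -> invertible_in BH (op_shift N u)) ->
  opnorm S <= / delta.
Proof.
  intros hN hS hi hdelta hpar hinv.
  destruct (Rle_or_lt (opnorm S) (/ delta)) as [|hlt]; [easy|exfalso].
  set (q := opnorm S) in *.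
  assert (hid : 0 < / delta) by now apply Rinv_0_lt_compat.
  assert (hq : 0 < q) by lra.
  assert (hqd : / q < delta).
  { rewrite <- (Rinv_inv delta). apply Rinv_lt_contravar; [now apply Rmult_lt_0_compat|easy]. }
  (* Strictly between [/ q] and [delta]: beyond the critical circle, yet inside the region where the
     resolvent of [N] is bounded. *)
  set (r := (/ q + delta) / 2).
  assert (hiq : 0 < / q) by now apply Rinv_0_lt_compat.
  destruct (resolvent_bounded_on_disc N r delta hN ltac:(unfold r; lra) hinv) as [M [hM0 hM]].
  set (K := r * (r * (M * M) + M)).
  assert (hK : 0 <= K).
  { unfold K. assert (0 <= r) by (unfold r; lra).
    apply Rmult_le_pos; [easy|]. assert (0 <= M * M) by nra. nra. }
  assert (h0 : forall u s, Cmod u <= r -> 0 <= s <= 1 -> exists V W,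
     is_power_resolvent S 0 u V /\ is_power_resolvent S 0 (Cmult (RtoC s) u) W /\
     opnorm (op_minus V W) <= K * (1 - s)).
  (* Since [1 - u S = S (N - u)], the inverse of [1 - u S] is [1 + u R] with [R] the resolvent of
     [N] at [u]. The constant [K] then comes from the resolvent identity. *)
  { assert (hres : forall u R, BH R -> is_inverse (op_shift N u) R ->
      is_power_resolvent S 0 u (op_plus op_one (op_scal u R))).
    { intros u R hR hRi. split; [bounded|]. split; apply functional_extensionality; intros x.
      - change (op_pow (2 ^ 0) S) with S. unfold_op; linear.
        transitivity (plus x (scal u (S (minus (N (R x)) (plus x (scal u (R x))))))).
        + linear. rewrite (inverse_app' N S (R x) hi). module; cbn; ring.
        + rewrite (shift_inverse_app N R u x hRi).
          replace (minus (plus x (scal u (R x))) (plus x (scal u (R x)))) with (zero : H) by module.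
          linear. module.
      - change (op_pow (2 ^ 0) S) with S. unfold_op; linear.
        pose proof (shift_inverse_app' N R u (S x) hR hRi) as e.
        rewrite (inverse_app N S x hi) in e.
        rewrite e. module; cbn; ring. }
    intros u s hu hs.
    assert (hr0 : 0 <= r) by (unfold r; lra).
    assert (hsu : Cmod (Cmult (RtoC s) u) <= r).
    { rewrite Cmod_mult, Cmod_R, Rabs_pos_eq by lra. pose proof (Cmod_ge_0 u). nra. }
    destruct (hinv u) as [R1 [hR1 hi1]]; [unfold r in *; lra|].
    destruct (hinv (Cmult (RtoC s) u)) as [R2 [hR2 hi2]]; [unfold r in *; lra|].
    exists (op_plus op_one (op_scal u R1)),
      (op_plus op_one (op_scal (Cmult (RtoC s) u) R2)).
    split; [now apply hres|]. split; [now apply hres|].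
    pose proof (hM u R1 hu hR1 hi1) as hM1. pose proof (hM _ R2 hsu hR2 hi2) as hM2.
    pose proof (opnorm_ge0 R1 hR1) as hp1. pose proof (opnorm_ge0 R2 hR2) as hp2.
    replace (op_minus _ _) with
      (op_plus (op_scal u (op_minus R1 R2)) (op_scal (Cmult u (RtoC (1 - s))) R2)).
    2:{ apply functional_extensionality; intros x. unfold_op. module;
        apply injective_projections; cbn; ring. }
    rewrite (resolvent_identity N R1 R2 _ _ hR1 hR2 hi1 hi2).
    assert (hd : Cmod (Cminus u (Cmult (RtoC s) u)) = (1 - s) * Cmod u).
    { replace (Cminus u (Cmult (RtoC s) u)) with (Cmult (RtoC (1 - s)) u)
        by (apply injective_projections; cbn; ring).
      rewrite Cmod_mult, Cmod_R, Rabs_pos_eq by lra. easy. }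
    eapply Rle_trans; [apply opnorm_plus; bounded|].
    rewrite !opnorm_scal, Cmod_mult, hd, Cmod_R, (Rabs_pos_eq (1 - s)) by (lra || bounded).
    pose proof (opnorm_mult R1 R2 hR1 hR2) as hm.
    assert (hmm : opnorm (op_mult R1 R2) <= M * M).
    { apply Rle_trans with (1 := hm). apply Rmult_le_compat; easy. }
    assert (hm0 := opnorm_ge0 (op_mult R1 R2) (BH_mult R1 R2 hR1 hR2)).
    pose proof (Cmod_ge_0 u) as hu0.
    apply Rle_trans with (r * ((1 - s) * r * (M * M)) + r * (1 - s) * M).
    + apply Rplus_le_compat.
      * apply Rmult_le_compat; [easy| |easy|].
        { apply Rmult_le_pos; [nra|easy]. }
        apply Rmult_le_compat; [nra|easy|nra|easy].
      * apply Rmult_le_compat; [nra|easy|nra|easy].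
    + unfold K. right. ring. }
  pose proof (power_resolvent_lipschitz S r K hS h0) as hlip.
  (* The three bounds keep [s] nonnegative, the Lipschitz variation below 1/4, and
     [u = (1 + eta) / q] inside the disc of radius [r]. *)
  set (eta := Rmin (/ 2) (Rmin (/ (8 * (K + 1))) (r * q - 1))).
  assert (hrq : 1 < r * q).
  { replace 1 with (/ q * q) by (field; lra). apply Rmult_lt_compat_r; [easy|unfold r; lra]. }
  assert (heta : 0 < eta).
  { unfold eta. repeat apply Rmin_pos; try lra. apply Rinv_0_lt_compat. lra. }
  assert (heta1 : eta <= / 2) by apply Rmin_l.
  assert (heta2 : K * (2 * eta) <= / 4).
  { assert (h : eta <= / (8 * (K + 1))) by (eapply Rle_trans; [apply Rmin_r|apply Rmin_l]).
    apply Rmult_le_compat_l with (r := 8 * (K + 1)) in h; [|lra].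
    rewrite Rinv_r in h by lra. nra. }
  assert (heta3 : 1 + eta <= r * q).
  { assert (h : eta <= r * q - 1) by (eapply Rle_trans; [apply Rmin_r|apply Rmin_r]). lra. }
  (* [u] lies just outside the circle of radius [/ q], and [s * u = (1 - eta) / q] just inside. *)
  set (u := (1 + eta) / q). set (s := (1 - eta) / (1 + eta)).
  assert (hu0 : 0 < u) by (apply Rdiv_lt_0_compat; lra).
  assert (huq : u * q = 1 + eta) by (unfold u; field; lra).
  assert (hur : u <= r) by (apply Rmult_le_reg_r with q; lra).
  assert (hs1 : s * (1 + eta) = 1 - eta) by (unfold s; field; lra).
  assert (hs : 0 <= s <= 1) by (split; nra).
  assert (hs2 : 1 - s <= 2 * eta) by nra.
  assert (hx : exists x : H, norm x <= 1 /\ 1 < u * norm (S x)).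
  { apply NNPP. intros hno. assert (hle : q <= / u).
    - apply opnorm_le; [easy|]. intros x hx1. apply Rnot_lt_le. intros hlt'. apply hno.
      exists x. split; [easy|]. replace 1 with (u * / u) by (field; lra).
      now apply Rmult_lt_compat_l.
    - apply Rmult_le_compat_l with (r := u) in hle; [|lra]. rewrite Rinv_r in hle by lra. lra. }
  destruct hx as [x [hx1 hx2]].
  assert (hSx : 0 < norm (S x)) by nra.
  destruct (pow_lt_1_zero (1 - eta) ltac:(rewrite Rabs_pos_eq; lra) (/ 8) ltac:(lra)) as [k1 hk1].
  destruct (Pow_x_infinity (u * norm (S x)) ltac:(rewrite Rabs_pos_eq; lra) 4) as [k2 hk2].
  set (k := Nat.max k1 k2). set (n := (2 ^ k)%nat).
  assert (hnk : (k < n)%nat) by (apply Nat.pow_gt_lin_r; lia).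
  specialize (hk1 n ltac:(lia)). specialize (hk2 n ltac:(lia)).
  rewrite Rabs_pos_eq in hk1 by (apply pow_le; lra).
  rewrite Rabs_pos_eq in hk2 by (apply pow_le; lra).
  destruct (hlip k (RtoC u) s) as [V [W [[hV hVi] [[hW hWi] hVW]]]];
    [rewrite Cmod_R, Rabs_pos_eq; lra|easy|].
  fold n in hVi, hWi. rewrite <- RtoC_mult in hWi. rewrite <- !RtoC_pow in hVi, hWi.
  pose proof (BH_pow n S hS) as hB. set (B := op_pow n S) in *.
  (* [V] is within 1/4 of [W], and [W] within 1/7 of the identity, because [(s u q)^n = (1 - eta)^n]
     is below 1/8. *)
  assert (hy : forall y, norm (minus (V y) y) <= / 2 * norm y).
  { intros y. replace (minus (V y) y) with (plus (op_minus V W y) (minus (W y) y))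
      by (unfold_op; module).
    assert (h1 : norm (op_minus V W y) <= / 4 * norm y).
    { apply Rle_trans with (1 := opnorm_bound _ y (BH_minus V W hV hW)).
      apply Rmult_le_compat_r; [apply norm_ge_0|]. nra. }
    assert (h2 : norm (minus (W y) y) <= / 8 * norm (W y)).
    { replace (minus (W y) y) with (scal (RtoC ((s * u) ^ n)) (B (W y))).
      - rewrite normH_scal, Cmod_R, Rabs_pos_eq by (apply pow_le; nra).
        apply Rle_trans with ((s * u) ^ n * (q ^ n * norm (W y))).
        + apply Rmult_le_compat_l; [apply pow_le; nra|]. now apply norm_op_pow.
        + rewrite <- Rmult_assoc, <- Rpow_mult_distr.
          apply Rmult_le_compat_r; [apply norm_ge_0|].
          replace (s * u * q) with (1 - eta) by (rewrite Rmult_assoc, huq; lra). lra.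
      - pose proof (inverse_app _ _ y hWi) as e. rewrite <- e at 3. unfold_op. module. }
    assert (h3 : norm (W y) <= norm (minus (W y) y) + norm y).
    { replace (W y) with (plus (minus (W y) y) y) at 1 by module. apply normH_triangle. }
    apply Rle_trans with (1 := normH_triangle _ _).
    pose proof (norm_ge_0 y). lra. }
  (* By construction [V y = x], so [|x - y| <= |y| / 2], which bounds [u^n |S^n x| = |x - y|] by 1,
     against the lower bound 4. *)
  set (y := op_minus op_one (op_scal (RtoC (u ^ n)) B) x).
  specialize (hy y). unfold y at 1 in hy. rewrite (inverse_app' _ _ x hVi) in hy.
  assert (hxy : minus x y = scal (RtoC (u ^ n)) (B x)) by (unfold y; unfold_op; module).
  assert (h1 : norm y <= norm (minus x y) + norm x).
  { rewrite normH_minus_sym. replace y with (plus (minus y x) x) at 1 by module.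
    apply normH_triangle. }
  assert (h2 : norm (minus x y) <= 1) by lra.
  rewrite hxy, normH_scal, Cmod_R, Rabs_pos_eq in h2 by (apply pow_le; lra).
  (* Paranormality passes to the inverse: it is the inequality for [N] at the vector [S (S z)]. *)
  assert (hparS : forall y, norm (S y) ^ 2 <= norm y * norm (S (S y))).
  { intros z. pose proof (hpar (S (S z))) as h.
    rewrite !(inverse_app N S _ hi) in h. lra. }
  pose proof (norm_op_pow_ge n S x hparS hSx hx1 ltac:(lia)) as h3.
  assert (h4 : (u * norm (S x)) ^ n <= u ^ n * norm (B x)).
  { rewrite Rpow_mult_distr. apply Rmult_le_compat_l; [apply pow_le; lra|easy]. }
  lra.
Qed.

Lemma normal_resolvent_bound T V z (delta : R) :
  BH T -> normal T -> BH V -> is_inverse (op_shift T z) V -> 0 < delta ->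
  (forall w, Cmod (Cminus w z) < delta -> ~ spectrum T w) ->
  opnorm V <= / delta.
Proof.
  intros hT hnorm hV hi hdelta hsp.
  apply (paranormal_inverse_bound (op_shift T z)); try easy.
  - unfold op_shift; bounded.
  - intros x. now apply norm_normal_shift_le.
  - intros u hu. apply NNPP. intros hno.
    apply (hsp (Cplus z u)); [now replace (Cminus (Cplus z u) z) with u by ring|].
    unfold spectrum.
    replace (op_minus T (op_scal (Cplus z u) op_one)) with (op_shift (op_shift T z) u); [easy|].
    unfold op_shift. op_eq.
Qed.

End ResolventBound.

(** * Compactness *)

Section CompactSets.

Lemma rectangle_compact (a b : R) :
  cover_compact (fun p : R * R => 0 <= fst p <= a /\ 0 <= snd p <= b).
Proof.
  intros I U hopen hcov.
  assert (hg : forall t : R * (R * unit), exists e : posreal,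
    (0 <= fst t <= a /\ 0 <= fst (snd t) <= b) -> exists i, forall x y,
      Rabs (x - fst t) < e -> Rabs (y - fst (snd t)) < e -> U i (x, y)).
  { intros [t1 [t2 tt']]; cbn [fst snd].
    destruct (classic (0 <= t1 <= a /\ 0 <= t2 <= b)) as [h|h].
    - destruct (hcov (t1, t2) h) as [i hi].
      destruct (hopen i (t1, t2) hi) as [e he]. exists e. intros _. exists i.
      intros x y hx hy. apply he. split; [exact hx|exact hy].
    - exists (mkposreal 1 Rlt_0_1). easy. }
  destruct (choice _ hg) as [g hg'].
  destruct (NNPP _ (compactness_list 2 (0, (0, tt)) (a, (b, tt)) g)) as [l hl].
  (* An [option], because the index type may be empty when the rectangle is. *)
  assert (hch : forall t : R * (R * unit), exists o : option I,
    (0 <= fst t <= a /\ 0 <= fst (snd t) <= b) -> exists i, o = Some i /\ forall x y,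
      Rabs (x - fst t) < g t -> Rabs (y - fst (snd t)) < g t -> U i (x, y)).
  { intros t. destruct (classic (0 <= fst t <= a /\ 0 <= fst (snd t) <= b)) as [h|h].
    - destruct (hg' t h) as [i hi]. exists (Some i). intros _. now exists i.
    - now exists None. }
  destruct (choice _ hch) as [o ho].
  exists (flat_map (fun t => match o t with Some i => [i] | None => [] end) l).
  intros [x y] hxy. cbn [fst snd] in hxy.
  destruct (hl (x, (y, tt))) as [[t1 [t2 []]] [ht1 [ht2 ht3]]]; [cbn; tauto|].
  cbn in ht2, ht3.
  destruct (ho (t1, (t2, tt))) as [i [hi1 hi2]]; [cbn; tauto|].
  exists i. split.
  - apply in_flat_map. exists (t1, (t2, tt)). split; [easy|]. rewrite hi1. now left.
  - apply hi2; cbn; tauto.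
Qed.

Lemma cover_compact_bounded (K : R * R -> Prop) : cover_compact K ->
  exists n : nat, forall p, K p -> fst p <= INR n /\ snd p <= INR n.
Proof.
  intros hK.
  destruct (hK nat (fun n p => fst p < INR n /\ snd p < INR n)) as [l hl].
  - intros n. apply open_and.
    + apply (open_comp fst (fun x : R => x < INR n)); [|apply open_lt].
      intros p _. apply continuous_fst.
    + apply (open_comp snd (fun x : R => x < INR n)); [|apply open_lt].
      intros p _. apply continuous_snd.
  - intros p _. destruct (INR_unbounded (Rmax (fst p) (snd p))) as [n hn].
    exists n. pose proof (Rmax_l (fst p) (snd p)); pose proof (Rmax_r (fst p) (snd p)). lra.
  - exists (list_max l). intros p hp. destruct (hl p hp) as [n [hn1 hn2]].
    assert (hn : (n <= list_max l)%nat).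
    { pose proof (proj1 (list_max_le l (list_max l)) (le_n _)) as h.
      rewrite Forall_forall in h. now apply h. }
    apply le_INR in hn. split; (apply Rle_trans with (INR n); [now left|easy]).
Qed.

Lemma bounded_on_rectangle (h : R -> R -> R) (a b : R) : bounded_on_compacts h ->
  exists M, 0 <= M /\ forall s t, 0 <= s <= a -> 0 <= t <= b -> h s t <= M.
Proof.
  intros hh. destruct (hh _ (rectangle_compact a b)) as [M hM].
  - intros p hp. unfold in_quadrant. lra.
  - exists (Rabs M). split; [apply Rabs_pos|]. intros s t hs ht.
    specialize (hM (s, t) ltac:(easy)). cbn in hM.
    pose proof (Rle_abs (h s t)). pose proof (Rle_abs M). lra.
Qed.

Fixpoint running_max (M : nat -> R) (n : nat) : R :=
  match n with
  | O => Rabs (M O)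
  | S n => Rmax (running_max M n) (Rabs (M (S n)))
  end.

Lemma running_max_ge (M : nat -> R) n : Rabs (M n) <= running_max M n.
Proof. destruct n as [|n]; cbn; [lra|apply Rmax_r]. Qed.

Lemma running_max_mono (M : nat -> R) n m : (n <= m)%nat -> running_max M n <= running_max M m.
Proof.
  intros h. induction h as [|m h IH]; [lra|].
  apply Rle_trans with (1 := IH). apply Rmax_l.
Qed.

(** A step function is enough, as no continuity is asked. The running maximum makes it monotone in
    the index, the numbers [M n] being unrelated to one another. *)
Lemma bounded_majorant (M : nat -> R) :
  exists g, bounded_on_compacts g /\
    forall s t, 0 <= s -> 0 <= t -> exists n, s <= INR n /\ t <= INR n /\ M n <= g s t.
Proof.
  set (ceil := fun x : R => Z.to_nat (up x)).
  assert (hceil : forall x, 0 <= x -> x <= INR (ceil x)).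
  { intros x hx. destruct (archimed x) as [h1 h2]. unfold ceil.
    rewrite INR_IZR_INZ, Z2Nat.id; [lra|]. apply le_IZR. lra. }
  exists (fun s t => running_max M (ceil (Rmax s t))). split.
  - intros K hK hq. destruct (cover_compact_bounded K hK) as [n hn].
    (* [up x] can be as large as [x + 1], so points bounded by [n] have index at most [S n]. *)
    exists (running_max M (S n)). intros [s t] hp. cbn [fst snd].
    destruct (hn _ hp) as [h1 h2]. cbn in h1, h2.
    destruct (hq _ hp) as [h3 h4]. cbn in h3, h4.
    rewrite Rabs_pos_eq.
    + apply running_max_mono. unfold ceil.
      destruct (archimed (Rmax s t)) as [h5 h6].
      assert (h7 : Rmax s t <= INR n) by now apply Rmax_lub.
      apply Nat2Z.inj_le. rewrite Z2Nat.id.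
      * apply le_IZR. rewrite <- INR_IZR_INZ, S_INR. lra.
      * apply le_IZR. pose proof (Rmax_l s t). lra.
    + eapply Rle_trans; [apply Rabs_pos|apply running_max_ge].
  - intros s t hs ht. exists (ceil (Rmax s t)).
    pose proof (Rmax_l s t); pose proof (Rmax_r s t).
    assert (Rmax s t <= INR (ceil (Rmax s t))) by (apply hceil; lra).
    repeat split; [lra|lra|].
    apply Rle_trans with (1 := Rle_abs _). apply running_max_ge.
Qed.

End CompactSets.

(** * Openness of the resolvent set and separation of spectra *)

Section Spectra.
Context {H : HilbertSpace}.
Implicit Types (A B T : H -> H) (z w p : C).

Lemma spectrum_complement_open T p : BH T -> ~ spectrum T p ->
  exists g, 0 < g /\ forall w, Cmod (Cminus w p) < g -> ~ spectrum T w.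
Proof.
  intros hT hp. apply NNPP in hp. destruct hp as [S [hS hi]].
  pose proof (opnorm_ge0 S hS) as hS0.
  exists (/ (2 * opnorm S + 1)). split; [apply Rinv_0_lt_compat; lra|].
  intros w hw hsp. apply hsp.
  destruct (resolvent_perturbation BH_algebra T S p w hT hS hi) as [V [hV [hVi _]]].
  - cbn. apply Rle_trans with (/ (2 * opnorm S + 1) * opnorm S).
    + apply Rmult_le_compat_r; lra.
    + apply Rmult_le_reg_l with (2 * opnorm S + 1); [lra|].
      rewrite <- Rmult_assoc, Rinv_r; lra.
  - now exists V.
Qed.

Lemma spectrum_bounded (alg : BanachSubalgebra H) T z : alg T -> spectrum T z ->
  Cmod z <= 2 * alg_norm alg T.
Proof.
  intros hT hz. apply Rnot_lt_le. intros hl. apply hz.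
  pose proof (alg_norm_ge0 alg T hT) as h0.
  destruct (resolvent_large alg T z hT) as [V [hV [hVi _]]].
  - intros ->. rewrite Cmod_0 in hl. lra.
  - lra.
  - exists V. split; [now apply (carrier_BH alg)|easy].
Qed.

(** Around each point either [A] has no spectrum within [g] or [B] has none within [2 g]; the factor
    2 leaves room to step from [z] to [w]. *)
Lemma spectra_separated A B : BH A -> BH B ->
  (forall z, ~ (spectrum A z /\ spectrum B z)) ->
  exists d, 0 < d /\ forall z w, spectrum A z -> spectrum B w -> d <= Cmod (Cminus z w).
Proof.
  intros hA hB hdis.
  assert (hloc : forall p, exists g, 0 < g /\
    ((forall z, Cmod (Cminus z p) < g -> ~ spectrum A z) \/
     (forall w, Cmod (Cminus w p) < 2 * g -> ~ spectrum B w))).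
  { intros p. destruct (classic (spectrum A p)) as [hp|hp].
    - assert (hp' : ~ spectrum B p) by (intros h; now apply (hdis p)).
      destruct (spectrum_complement_open B p hB hp') as [g [hg hg']].
      exists (g / 2). split; [lra|right]. intros w hw. apply hg'. lra.
    - destruct (spectrum_complement_open A p hA hp) as [g [hg hg']].
      exists g. split; [lra|now left]. }
  destruct (choice _ hloc) as [g hg].
  destruct (disc_gauge (2 * opnorm A) g (fun p => proj1 (hg p))) as [d [hd hcov]].
  exists d. split; [easy|]. intros z w hz hw.
  destruct (hcov z (spectrum_bounded BH_algebra A z hA hz)) as [p [h1 h2]].
  destruct (proj2 (hg p)) as [h3|h3]; [now elim (h3 z)|].
  apply Rnot_lt_le. intros hlt. apply (h3 w); [|easy].
  replace (Cminus w p) with (Cplus (Copp (Cminus z w)) (Cminus z p)) by ring.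
  apply Rle_lt_trans with (1 := Cmod_triangle _ _). rewrite Cmod_opp. lra.
Qed.

Lemma spectral_dist_ge0 A B : 0 <= spectral_dist A B.
Proof.
  unfold spectral_dist. set (E := fun r => _).
  destruct (Glb_Rbar_correct E) as [_ hlow].
  assert (h : is_lb_Rbar E 0).
  { intros r [z [w [_ [_ ->]]]]. apply Cmod_ge_0. }
  specialize (hlow (Finite 0) h). destruct (Glb_Rbar E); cbn in *; lra.
Qed.

(** The positive lower bound from [spectra_separated] is essential: since [/ 0 = 0], a zero distance
    would satisfy the bound on its inverse for free. *)
Lemma spectral_dist_separation A B (n : R) : BH A -> BH B -> 0 < n ->
  (forall z, ~ (spectrum A z /\ spectrum B z)) -> / spectral_dist A B <= n ->
  forall z w, spectrum A z -> spectrum B w -> / n <= Cmod (Cminus z w).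
Proof.
  intros hA hB hn hdis hle z w hz hw.
  destruct (spectra_separated A B hA hB hdis) as [d [hd hsep]].
  unfold spectral_dist in hle. set (E := fun r => _) in hle.
  destruct (Glb_Rbar_correct E) as [hlb hglb].
  assert (hE : E (Cmod (Cminus z w))) by now exists z, w.
  assert (hd' : is_lb_Rbar E d).
  { intros r [z' [w' [hz' [hw' ->]]]]. now apply hsep. }
  specialize (hlb _ hE). specialize (hglb (Finite d) hd').
  destruct (Glb_Rbar E) as [l| |]; cbn in *; [|easy|easy].
  apply Rle_trans with l; [|easy].
  rewrite <- (Rinv_inv l). apply Rinv_le_contravar; [apply Rinv_0_lt_compat; lra|easy].
Qed.

End Spectra.

(** * Summation over a square grid *)

Section FiniteSums.
Context {H : HilbertSpace}.
Implicit Types (u v : nat -> H -> H) (f : nat -> nat -> H -> H) (X Y : H -> H).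

Lemma op_sum_ext n u v : (forall k, (k < n)%nat -> u k = v k) -> op_sum n u = op_sum n v.
Proof.
  intros h. induction n as [|n IH]; cbn; [easy|].
  rewrite IH, h by (intros; try apply h; lia). easy.
Qed.

Lemma op_sum_plus n u v :
  op_sum n (fun k => op_plus (u k) (v k)) = op_plus (op_sum n u) (op_sum n v).
Proof.
  induction n as [|n IH]; cbn [op_sum]; [unfold op_zero; op_eq|]. rewrite IH. op_eq.
Qed.

Lemma op_sum_zero n : op_sum n (fun _ => op_zero (H := H)) = op_zero.
Proof. induction n as [|n IH]; cbn [op_sum]; [easy|]. rewrite IH. unfold op_zero. op_eq. Qed.

Lemma op_sum_exchange m n f :
  op_sum m (fun i => op_sum n (fun j => f i j)) = op_sum n (fun j => op_sum m (fun i => f i j)).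
Proof.
  induction m as [|m IH]; cbn [op_sum].
  - now rewrite op_sum_zero.
  - now rewrite op_sum_plus, IH.
Qed.

Definition op_linear (Phi : (H -> H) -> H -> H) : Prop :=
  (forall X Y, Phi (op_plus X Y) = op_plus (Phi X) (Phi Y)) /\
  (forall (c : C) X, Phi (op_scal c X) = op_scal c (Phi X)).

Lemma op_linear_zero Phi : op_linear Phi -> Phi op_zero = op_zero.
Proof.
  intros [_ h].
  replace (op_zero (H := H)) with (op_scal (RtoC 0) (op_zero (H := H))) at 1
    by (unfold op_zero; op_eq).
  rewrite h. unfold op_zero. op_eq.
Qed.

Lemma op_linear_minus Phi X Y : op_linear Phi ->
  Phi (op_minus X Y) = op_minus (Phi X) (Phi Y).
Proof. intros [h1 h2]. now rewrite !op_minus_plus, h1, h2. Qed.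

Lemma op_linear_sum Phi n u : op_linear Phi ->
  Phi (op_sum n u) = op_sum n (fun k => Phi (u k)).
Proof.
  intros h. induction n as [|n IH]; cbn [op_sum]; [now apply op_linear_zero|].
  now rewrite (proj1 h), IH.
Qed.

Lemma op_linear_mult_l (S : H -> H) : BH S -> op_linear (op_mult S).
Proof. intros hS. split; intros; op_eq. Qed.

Lemma op_linear_mult_r (S : H -> H) : op_linear (fun X => op_mult X S).
Proof. split; intros; op_eq. Qed.

Definition op_if (b : bool) X : H -> H := if b then X else op_zero.

Lemma op_if_zero b : op_if b op_zero = op_zero.
Proof. now destruct b. Qed.

(** The sum telescopes: at an interior index either the selection does not change or the term
    vanishes. *)
Lemma summation_by_parts m (chi : nat -> bool) u :
  (forall j, (S j <= m)%nat -> chi j = chi (S j) \/ u (S j) = op_zero) ->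
  op_sum (S m) (fun j => op_if (chi j) (op_minus (u j) (u (S j))))
  = op_minus (op_if (chi O) (u O)) (op_if (chi m) (u (S m))).
Proof.
  intros hjump. induction m as [|m IH].
  - cbn. destruct (chi O); unfold op_if, op_zero; op_eq.
  - remember (S m) as m' eqn:em. cbn [op_sum]. rewrite IH by (intros; apply hjump; lia).
    subst m'. destruct (hjump m (le_n _)) as [e|e].
    + rewrite e. destruct (chi O), (chi (S m)); unfold op_if, op_zero; op_eq.
    + rewrite e. destruct (chi O), (chi m), (chi (S m)); unfold op_if, op_zero; op_eq.
Qed.

End FiniteSums.

Section Grid.
Context {H : HilbertSpace}.
Implicit Types (X Y Q : H -> H) (G F : C -> H -> H) (chi : nat -> nat -> bool).

(* [e] times the counterclockwise sum of the values at the midpoints of the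
   bottom, top, right and left edges of a square of side [e] *)
Definition edge_sum (e : R) (Gb Gt Gr Gl : H -> H) : H -> H :=
  op_scal (RtoC e) (op_plus (op_minus Gb Gt) (op_scal Ci (op_minus Gr Gl))).

Context (L : R) (m : nat).

Definition mesh : R := 2 * L / INR m.
Definition node (i : nat) : R := - L + INR i * mesh.
Definition centre (i j : nat) : C := (node i + mesh / 2, node j + mesh / 2).
Definition hmid (i j : nat) : C := (node i + mesh / 2, node j).
Definition vmid (i j : nat) : C := (node i, node j + mesh / 2).

Definition square_sum G (i j : nat) : H -> H :=
  edge_sum mesh (G (hmid i j)) (G (hmid i (S j))) (G (vmid (S i) j)) (G (vmid i j)).

(* Discretises the integral of [G] along the boundary of the union of the
   squares selected by [chi]. *)
Definition grid_sum chi G : H -> H :=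
  op_sum m (fun i => op_sum m (fun j => op_if (chi i j) (square_sum G i j))).

Lemma grid_sum_linear Phi chi G : op_linear Phi ->
  Phi (grid_sum chi G) = grid_sum chi (fun z => Phi (G z)).
Proof.
  intros h. unfold grid_sum. rewrite op_linear_sum by easy. apply op_sum_ext; intros i _.
  rewrite op_linear_sum by easy. apply op_sum_ext; intros j _.
  destruct (chi i j); cbn; [|now apply op_linear_zero].
  unfold square_sum, edge_sum.
  now rewrite (proj2 h), (proj1 h), (proj2 h), !(op_linear_minus Phi _ _ h).
Qed.

Lemma grid_sum_minus chi F G :
  grid_sum chi (fun z => op_minus (F z) (G z)) = op_minus (grid_sum chi F) (grid_sum chi G).
Proof.
  unfold grid_sum. rewrite op_minus_plus.
  assert (hs : op_linear (H := H) (op_scal (RtoC (-1)))) by (split; intros; op_eq).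
  rewrite (op_linear_sum _ _ _ hs), <- op_sum_plus. apply op_sum_ext; intros i _.
  rewrite (op_linear_sum _ _ _ hs), <- op_sum_plus. apply op_sum_ext; intros j _.
  destruct (chi i j); cbn; unfold square_sum, edge_sum, op_zero.
  - apply functional_extensionality; intros x; unfold_op.
    module; apply injective_projections; cbn; ring.
  - op_eq.
Qed.

Lemma grid_sum_split chi G :
  grid_sum (fun _ _ => true) G
  = op_plus (grid_sum chi G) (grid_sum (fun i j => negb (chi i j)) G).
Proof.
  unfold grid_sum. rewrite <- op_sum_plus. apply op_sum_ext; intros i _.
  rewrite <- op_sum_plus. apply op_sum_ext; intros j _.
  destruct (chi i j); unfold op_if, negb, op_zero; op_eq.
Qed.

(** An interior edge belongs to two squares, with opposite signs. It cancels if both are selected,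
    and carries the value zero if exactly one is. *)
Lemma grid_sum_boundary n chi G : m = S n ->
  (forall i j, (i < m)%nat -> (S j < m)%nat ->
     chi i j = chi i (S j) \/ G (hmid i (S j)) = op_zero) ->
  (forall i j, (S i < m)%nat -> (j < m)%nat ->
     chi i j = chi (S i) j \/ G (vmid (S i) j) = op_zero) ->
  grid_sum chi G = op_sum m (fun i => edge_sum mesh
    (op_if (chi i O) (G (hmid i O))) (op_if (chi i n) (G (hmid i m)))
    (op_if (chi n i) (G (vmid m i))) (op_if (chi O i) (G (vmid O i)))).
Proof.
  intros hm hh hv. unfold grid_sum.
  assert (hs : op_linear (H := H) (op_scal (RtoC mesh))) by (split; intros; op_eq).
  (* The factor [- i] turns right minus left into left minus right, the order that telescopes. *)
  assert (hs' : op_linear (H := H) (op_scal (Cmult (RtoC mesh) (Copp Ci)))) by (split; intros; op_eq).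
  transitivity (op_plus
    (op_sum m (fun i => op_sum m (fun j =>
      op_scal (RtoC mesh) (op_if (chi i j) (op_minus (G (hmid i j)) (G (hmid i (S j))))))))
    (op_sum m (fun i => op_sum m (fun j =>
      op_scal (Cmult (RtoC mesh) (Copp Ci)) (op_if (chi i j) (op_minus (G (vmid i j)) (G (vmid (S i) j)))))))).
  - rewrite <- op_sum_plus. apply op_sum_ext; intros i _.
    rewrite <- op_sum_plus. apply op_sum_ext; intros j _.
    unfold square_sum, edge_sum. destruct (chi i j); unfold op_if, op_zero; op_eq.
  - rewrite (op_sum_exchange m m (fun i j => op_scal (Cmult (RtoC mesh) (Copp Ci)) _)).
    rewrite <- op_sum_plus. apply op_sum_ext; intros i hi.
    rewrite <- (op_linear_sum _ _ _ hs), <- (op_linear_sum _ _ _ hs'), hm.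
    rewrite (summation_by_parts n (fun j => chi i j) (fun j => G (hmid i j))).
    2:{ intros j hj. apply hh; lia. }
    rewrite (summation_by_parts n (fun j => chi j i) (fun j => G (vmid j i))).
    2:{ intros j hj. apply hv; lia. }
    unfold edge_sum. op_eq.
Qed.

End Grid.

(** * Norm estimates for grid sums *)

Section GridEstimates.
Context {H : HilbertSpace} (alg : BanachSubalgebra H).
Implicit Types (S T V W X Y : H -> H) (G F : C -> H -> H) (chi : nat -> nat -> bool).

Lemma alg_edge_sum e Gb Gt Gr Gl : alg Gb -> alg Gt -> alg Gr -> alg Gl ->
  alg (edge_sum e Gb Gt Gr Gl).
Proof.
  intros hb ht hr hl. unfold edge_sum.
  apply carrier_scal, carrier_plus; [now apply alg_minus|].
  apply carrier_scal. now apply alg_minus.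
Qed.

Lemma alg_norm_edge_sum e c Gb Gt Gr Gl : 0 <= e ->
  alg Gb -> alg Gt -> alg Gr -> alg Gl ->
  alg_norm alg Gb <= c -> alg_norm alg Gt <= c ->
  alg_norm alg Gr <= c -> alg_norm alg Gl <= c ->
  alg_norm alg (edge_sum e Gb Gt Gr Gl) <= 4 * e * c.
Proof.
  intros he hb ht hr hl nb nt nr nl. unfold edge_sum.
  assert (h1 : alg (op_minus Gb Gt)) by now apply alg_minus.
  assert (h2 : alg (op_minus Gr Gl)) by now apply alg_minus.
  assert (h3 : alg (op_scal Ci (op_minus Gr Gl))) by now apply carrier_scal.
  rewrite alg_norm_scal, Cmod_R, Rabs_pos_eq by (easy || now apply carrier_plus).
  pose proof (alg_norm_plus alg _ _ h1 h3) as e1.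
  rewrite alg_norm_scal, Cmod_Ci in e1 by easy.
  pose proof (alg_norm_minus alg _ _ hb ht). pose proof (alg_norm_minus alg _ _ hr hl).
  replace (4 * e * c) with (e * (4 * c)) by ring.
  apply Rmult_le_compat_l; lra.
Qed.

Lemma alg_grid_sum L m chi G :
  (forall i j, (i < m)%nat -> (j < m)%nat -> chi i j = true -> alg (square_sum L m G i j)) ->
  alg (grid_sum L m chi G).
Proof.
  intros h. apply alg_sum; intros i hi. apply alg_sum; intros j hj.
  destruct (chi i j) eqn:e; [now apply h|apply alg_zero].
Qed.

Lemma alg_norm_grid_sum L m chi G c : 0 <= c ->
  (forall i j, (i < m)%nat -> (j < m)%nat -> chi i j = true ->
     alg (square_sum L m G i j) /\ alg_norm alg (square_sum L m G i j) <= c) ->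
  alg_norm alg (grid_sum L m chi G) <= INR m * (INR m * c).
Proof.
  intros hc h.
  assert (h' : forall i j, (i < m)%nat -> (j < m)%nat ->
    alg (op_if (chi i j) (square_sum L m G i j)) /\
    alg_norm alg (op_if (chi i j) (square_sum L m G i j)) <= c).
  { intros i j hi hj. destruct (chi i j) eqn:e; [now apply h|].
    cbn. rewrite alg_norm_zero. split; [apply alg_zero|easy]. }
  apply alg_norm_sum. intros i hi. split.
  - apply alg_sum. intros j hj. now apply h'.
  - apply alg_norm_sum. intros j hj. now apply h'.
Qed.

(* The quadrature is exact on polynomials of degree at most 2, so only the
   second-order remainder of the resolvent contributes. *)
Lemma resolvent_square_sum T (c : C) (e M : R) (R : C -> H -> H) :
  0 <= e -> 0 <= M -> (forall z, alg (R z)) ->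
  (forall z, Cmod (Cminus z c) <= e / 2 ->
     is_inverse (op_shift T z) (R z) /\ alg_norm alg (R z) <= M) ->
  alg_norm alg (edge_sum e
    (R (Cminus c (Cmult Ci (RtoC (e / 2))))) (R (Cplus c (Cmult Ci (RtoC (e / 2)))))
    (R (Cplus c (RtoC (e / 2)))) (R (Cminus c (RtoC (e / 2))))) <= e ^ 3 * M ^ 3.
Proof.
  intros he hM halg hR.
  assert (hnear : forall h, Cmod h <= e / 2 ->
    is_inverse (op_shift T (Cplus c h)) (R (Cplus c h)) /\ alg_norm alg (R (Cplus c h)) <= M).
  { intros h hh. apply hR. now replace (Cminus (Cplus c h) c) with h by ring. }
  assert (hc0 : is_inverse (op_shift T c) (R c) /\ alg_norm alg (R c) <= M).
  { apply hR. replace (Cminus c c) with (RtoC 0) by ring. rewrite Cmod_0. lra. }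
  destruct hc0 as [hci hcM].
  (* The resolvent identity used twice: [R(c+h) = R(c) + h R(c)^2 + h^2 R(c+h) R(c)^2]. *)
  assert (hexp : forall h x, Cmod h <= e / 2 ->
    R (Cplus c h) x = plus (plus (R c x) (scal h (R c (R c x))))
      (scal (Cmult h h) (R (Cplus c h) (R c (R c x))))).
  { intros h x hh.
    pose proof (resolvent_identity T (R (Cplus c h)) (R c) _ _
      (carrier_BH alg _ (halg _)) (carrier_BH alg _ (halg _)) (proj1 (hnear h hh)) hci) as hid.
    replace (Cminus (Cplus c h) c) with h in hid by ring.
    assert (hx : forall y, R (Cplus c h) y = plus (R c y) (scal h (R (Cplus c h) (R c y)))).
    { intros y. pose proof (f_equal (fun U => U y) hid) as hy. unfold_op.
      rewrite <- hy. module. }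
    rewrite (hx x) at 1. rewrite (hx (R c x)) at 1. module. }
  set (hi := Cmult Ci (RtoC (e / 2))).
  set (hr := RtoC (e / 2)).
  assert (hrm : Cmod hr <= e / 2) by (unfold hr; rewrite Cmod_R, Rabs_pos_eq; lra).
  assert (him : Cmod hi <= e / 2) by (unfold hi; rewrite Cmod_mult, Cmod_Ci; fold hr; lra).
  assert (hrm' : Cmod (Copp hr) <= e / 2) by (rewrite Cmod_opp; easy).
  assert (him' : Cmod (Copp hi) <= e / 2) by (rewrite Cmod_opp; easy).
  change (Cminus c hi) with (Cplus c (Copp hi)). change (Cminus c hr) with (Cplus c (Copp hr)).
  (* The squared displacements are [- (e/2)^2] at the bottom and top and [(e/2)^2] at the right and
     left, whence the factors -1 and the new side. *)
  replace (edge_sum e _ _ _ _) with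
    (op_mult (edge_sum (e * (e / 2 * (e / 2)))
      (op_scal (RtoC (-1)) (R (Cplus c (Copp hi)))) (op_scal (RtoC (-1)) (R (Cplus c hi)))
      (R (Cplus c hr)) (R (Cplus c (Copp hr)))) (op_mult (R c) (R c))).
  2:{ apply functional_extensionality; intros x. unfold edge_sum; unfold_op.
      rewrite (hexp hi x him), (hexp hr x hrm), (hexp (Copp hi) x him'), (hexp (Copp hr) x hrm').
      set (y := R c (R c x)).
      generalize (R (Cplus c hi) y) (R (Cplus c (Copp hi)) y) (R (Cplus c hr) y)
        (R (Cplus c (Copp hr)) y) (R c x). intros y1 y2 y3 y4 y5.
      unfold hi, hr. module; apply injective_projections; cbn; field. }
  assert (hm : alg (op_mult (R c) (R c))) by now apply carrier_mult.
  assert (hmM : alg_norm alg (op_mult (R c) (R c)) <= M * M).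
  { apply Rle_trans with (1 := alg_norm_mult alg _ _ (halg c) (halg c)).
    apply Rmult_le_compat; try easy; now apply alg_norm_ge0. }
  assert (hsc : forall z, alg (op_scal (RtoC (-1)) (R z))) by (intros; now apply carrier_scal).
  assert (hsn : forall z, alg_norm alg (op_scal (RtoC (-1)) (R z)) = alg_norm alg (R z)).
  { intros z. rewrite alg_norm_scal, Cmod_R, Rabs_left by (easy || lra). lra. }
  eapply Rle_trans; [apply alg_norm_mult; [now apply alg_edge_sum|easy]|].
  apply Rle_trans with (4 * (e * (e / 2 * (e / 2))) * M * (M * M)); [|right; field].
  apply Rmult_le_compat.
  - apply alg_norm_ge0. now apply alg_edge_sum.
  - now apply alg_norm_ge0.
  - apply alg_norm_edge_sum; try easy; rewrite ?hsn; try (now apply hnear).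
    assert (0 <= e / 2) by lra. assert (0 <= e / 2 * (e / 2)) by now apply Rmult_le_pos.
    now apply Rmult_le_pos.
  - easy.
Qed.

End GridEstimates.

(** * Geometry of the grid and its winding number *)

Section Nodes.
Context (L : R) (m : nat).
Context (hL : 0 < L) (hm : (0 < m)%nat).

Lemma mesh_pos : 0 < mesh L m.
Proof. unfold mesh. apply Rdiv_lt_0_compat; [lra|now apply lt_0_INR]. Qed.

Lemma mesh_total : INR m * mesh L m = 2 * L.
Proof. unfold mesh. field. apply not_0_INR. lia. Qed.

Lemma node_bounds i : (i <= m)%nat -> - L <= node L m i <= L.
Proof.
  intros hi. unfold node. pose proof mesh_pos. pose proof mesh_total.
  pose proof (pos_INR i). apply le_INR in hi.
  assert (0 <= INR i * mesh L m) by nra.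
  assert (INR i * mesh L m <= INR m * mesh L m) by nra. lra.
Qed.

Lemma node_mid_bounds i : (i < m)%nat -> - L <= node L m i + mesh L m / 2 <= L.
Proof.
  intros hi. pose proof mesh_pos.
  pose proof (node_bounds i ltac:(lia)). pose proof (node_bounds (S i) ltac:(lia)) as h.
  unfold node in *. rewrite S_INR in h. lra.
Qed.

Lemma node_first : node L m 0 = - L.
Proof. unfold node. cbn. ring. Qed.

Lemma node_last : node L m m = L.
Proof. unfold node. rewrite mesh_total. ring. Qed.

Lemma hmid_bottom i j :
  hmid L m i j = Cminus (centre L m i j) (Cmult Ci (RtoC (mesh L m / 2))).
Proof. apply injective_projections; cbn; field. Qed.

Lemma hmid_top i j :
  hmid L m i (S j) = Cplus (centre L m i j) (Cmult Ci (RtoC (mesh L m / 2))).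
Proof.
  apply injective_projections; cbn [hmid centre fst snd Cplus Cmult Ci RtoC]; unfold node;
    rewrite ?S_INR; field.
Qed.

Lemma vmid_right i j : vmid L m (S i) j = Cplus (centre L m i j) (RtoC (mesh L m / 2)).
Proof.
  apply injective_projections; cbn [vmid centre fst snd Cplus RtoC]; unfold node;
    rewrite ?S_INR; field.
Qed.

Lemma vmid_left i j : vmid L m i j = Cminus (centre L m i j) (RtoC (mesh L m / 2)).
Proof. apply injective_projections; cbn; field. Qed.

Lemma hmid_norm i j : (i < m)%nat -> (j <= m)%nat -> Cmod (hmid L m i j) <= 2 * L.
Proof.
  intros hi hj. apply Rle_trans with (1 := Cmod_le_components _). cbn [hmid fst snd].
  pose proof (node_mid_bounds i hi). pose proof (node_bounds j hj).
  assert (Rabs (node L m i + mesh L m / 2) <= L) by (apply Rabs_le; lra).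
  assert (Rabs (node L m j) <= L) by (apply Rabs_le; lra). lra.
Qed.

Lemma vmid_norm i j : (i <= m)%nat -> (j < m)%nat -> Cmod (vmid L m i j) <= 2 * L.
Proof.
  intros hi hj. apply Rle_trans with (1 := Cmod_le_components _). cbn [vmid fst snd].
  pose proof (node_mid_bounds j hj). pose proof (node_bounds i hi).
  assert (Rabs (node L m j + mesh L m / 2) <= L) by (apply Rabs_le; lra).
  assert (Rabs (node L m i) <= L) by (apply Rabs_le; lra). lra.
Qed.

Lemma hmid_boundary_norm i j : j = O \/ j = m -> L <= Cmod (hmid L m i j).
Proof.
  intros hj. apply Rle_trans with (2 := snd_le_Cmod _). cbn [hmid snd].
  destruct hj as [-> | ->]; [rewrite node_first|rewrite node_last].
  - rewrite Rabs_Ropp, Rabs_pos_eq; lra.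
  - rewrite Rabs_pos_eq; lra.
Qed.

Lemma vmid_boundary_norm i j : i = O \/ i = m -> L <= Cmod (vmid L m i j).
Proof.
  intros hi. apply Rle_trans with (2 := fst_le_Cmod _). cbn [vmid fst].
  destruct hi as [-> | ->]; [rewrite node_first|rewrite node_last].
  - rewrite Rabs_Ropp, Rabs_pos_eq; lra.
  - rewrite Rabs_pos_eq; lra.
Qed.

Fixpoint csum (n : nat) (c : nat -> C) : C :=
  match n with
  | O => RtoC 0
  | S n => Cplus (csum n c) (c n)
  end.

(* Discretises the integral of [1 / z] along the boundary of the box. *)
Definition box_winding : C :=
  csum m (fun i => Cmult (RtoC (mesh L m))
    (Cplus (Cminus (Cinv (hmid L m i 0)) (Cinv (hmid L m i m)))
           (Cmult Ci (Cminus (Cinv (vmid L m m i)) (Cinv (vmid L m 0 i)))))).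

Lemma csum_Im_ge n c (a : R) : (forall k, (k < n)%nat -> a <= Im (c k)) -> INR n * a <= Im (csum n c).
Proof.
  intros h. induction n as [|n IH]; [cbn; lra|].
  rewrite S_INR. cbn [csum].
  assert (h1 : INR n * a <= Im (csum n c)) by (apply IH; intros; apply h; lia).
  assert (h2 := h n ltac:(lia)).
  change (Im (Cplus (csum n c) (c n))) with (Im (csum n c) + Im (c n)). lra.
Qed.

Lemma im_le_Cmod (z : C) : Im z <= Cmod z.
Proof. exact (Rle_trans _ _ _ (Rle_abs _) (snd_le_Cmod z)). Qed.

(** Each term has imaginary part [4 mesh L / (x^2 + L^2)], at least [2 mesh / L] because [|x| <= L],
    and the [m] meshes add up to [2 L]. *)
Lemma box_winding_ge : 4 <= Cmod box_winding.
Proof.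
  apply Rle_trans with (2 := im_le_Cmod _).
  replace 4 with (INR m * (mesh L m * (4 * / (2 * L)))).
  2:{ rewrite <- Rmult_assoc, mesh_total. field. lra. }
  apply csum_Im_ge. intros i hi.
  unfold hmid, vmid. rewrite node_first, node_last.
  pose proof (node_mid_bounds i hi) as hx. set (x := node L m i + mesh L m / 2) in *.
  assert (hp : 0 < x * x + L * L) by nra.
  assert (hz : / (2 * L) <= L / (x * x + L * L)).
  { apply Rmult_le_reg_r with (2 * L * (x * x + L * L)); [nra|].
    replace (/ (2 * L) * (2 * L * (x * x + L * L))) with (x * x + L * L) by (field; lra).
    replace (L / (x * x + L * L) * (2 * L * (x * x + L * L))) with (2 * L * L) by (field; lra).
    nra. }
  replace (Im _) with (mesh L m * (4 * (L / (x * x + L * L)))).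
  - apply Rmult_le_compat_l; [left; apply mesh_pos|]. lra.
  - unfold Im, Cminus, Cmult, Cplus, Cinv, Ci, RtoC, Copp. cbn [fst snd]. field. nra.
Qed.

End Nodes.

(** * Separation of two spectra by a grid *)

Section SeparatingGrid.
Context {H : HilbertSpace} (alg : BanachSubalgebra H).
Implicit Types (S T V W X Y : H -> H) (G F : C -> H -> H) (chi : nat -> nat -> bool).

Lemma op_sum_scal n c X : op_sum n (fun k => op_scal (c k) X) = op_scal (csum n c) X.
Proof.
  induction n as [|n IH]; cbn [op_sum csum]; [unfold op_zero; op_eq|]. rewrite IH. op_eq.
Qed.

(** On the outer boundary the resolvent is [- 1/z + T R(z) / z]. The second term is at most
    [2 e n / L^2], with [e] the norm of the identity, and the boundary has length [8 L]. *)
Lemma boundary_sum_resolvent L m n T (Rs : C -> H -> H) :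
  0 < L -> (0 < m)%nat -> alg T -> alg_norm alg T <= n -> 2 * n <= L ->
  (forall z, alg (Rs z)) -> (forall z, L <= Cmod z -> is_inverse (op_shift T z) (Rs z)) ->
  alg_norm alg (op_plus
    (op_sum m (fun i => edge_sum (mesh L m) (Rs (hmid L m i 0)) (Rs (hmid L m i m))
       (Rs (vmid L m m i)) (Rs (vmid L m 0 i))))
    (op_scal (box_winding L m) op_one)) <= 16 * alg_norm alg op_one * n / L.
Proof.
  intros hL hm hT hTn hn halg hR.
  set (e := alg_norm alg op_one).
  pose proof (alg_norm_ge0 alg T hT) as hT0.
  set (D := fun z => op_scal (Cinv z) (op_mult T (Rs z))).
  assert (hD : forall z, L <= Cmod z ->
    Rs z = op_minus (D z) (op_scal (Cinv z) op_one) /\ alg (D z) /\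
    alg_norm alg (D z) <= 2 * e * n / (L * L)).
  { intros z hz.
    assert (hz0 : z <> RtoC 0) by (intros ->; rewrite Cmod_0 in hz; lra).
    assert (hDz : alg (op_mult T (Rs z))) by now apply carrier_mult.
    split; [|split; [now apply carrier_scal|]].
    - apply functional_extensionality; intros x. unfold D; unfold_op.
      rewrite (shift_inverse_app T (Rs z) z x (hR z hz)). module; now field.
    - unfold D. rewrite alg_norm_scal, Cmod_inv by easy.
      destruct (resolvent_large alg T z hT hz0 ltac:(lra)) as [V [hV [hVi hVn]]].
      rewrite (inverse_unique _ _ _ (hR z hz) hVi). fold e in hVn.
      pose proof (alg_norm_ge0 alg V hV) as hV0.
      assert (he : 0 <= e) by apply alg_norm_ge0, carrier_one.
      assert (hiz : / Cmod z <= / L) by (apply Rinv_le_contravar; lra).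
      assert (hiz0 : 0 < / Cmod z) by (apply Rinv_0_lt_compat; lra).
      assert (hV1 : alg_norm alg V <= 2 * e * / L).
      { apply Rle_trans with (1 := hVn). apply Rmult_le_compat_l; lra. }
      apply Rle_trans with (/ L * (n * (2 * e * / L))).
      + apply Rmult_le_compat; [lra|apply alg_norm_ge0; now apply carrier_mult|easy|].
        apply Rle_trans with (1 := alg_norm_mult alg T V hT hV).
        now apply Rmult_le_compat.
      + right. field. lra. }
  assert (hh : forall i j, (j = 0 \/ j = m)%nat -> L <= Cmod (hmid L m i j))
    by (intros; now apply hmid_boundary_norm).
  assert (hv : forall i j, (i = 0 \/ i = m)%nat -> L <= Cmod (vmid L m i j))
    by (intros; now apply vmid_boundary_norm).
  replace (op_plus _ _) with (op_sum m (fun i => edge_sum (mesh L m)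
    (D (hmid L m i 0)) (D (hmid L m i m)) (D (vmid L m m i)) (D (vmid L m 0 i)))).
  2:{ unfold box_winding. rewrite <- op_sum_scal, <- op_sum_plus.
      apply op_sum_ext; intros i _.
      rewrite (proj1 (hD (hmid L m i 0) ltac:(apply hh; auto))).
      rewrite (proj1 (hD (hmid L m i m) ltac:(apply hh; auto))).
      rewrite (proj1 (hD (vmid L m m i) ltac:(apply hv; auto))).
      rewrite (proj1 (hD (vmid L m 0 i) ltac:(apply hv; auto))).
      unfold edge_sum. op_eq. }
  pose proof (mesh_pos L m hL hm) as hmesh.
  apply Rle_trans with (INR m * (4 * mesh L m * (2 * e * n / (L * L)))).
  - apply alg_norm_sum. intros i _. split.
    + apply alg_edge_sum; apply hD; (apply hh || apply hv); auto.
    + apply alg_norm_edge_sum; try (apply hD; (apply hh || apply hv); now auto). lra.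
  - right. replace (INR m * (4 * mesh L m * (2 * e * n / (L * L))))
      with (INR m * mesh L m * (8 * e * n / (L * L))) by (field; lra).
    rewrite mesh_total by easy. field. lra.
Qed.

Definition spectral_gap T (delta : R) (z : C) : Prop :=
  forall w, Cmod (Cminus w z) < delta -> ~ spectrum T w.

(** The bound [M] sees [T] only through [n]: the resolvent has operator norm at most [/ delta] and
    the shifted operator has norm at most [n + rho |1|], so [h] is evaluated on a fixed
    rectangle. *)
Lemma controlled_resolvent (n delta rho : R) : norm_controlled_inversion alg ->
  0 < delta ->
  exists M, 0 <= M /\ forall T, alg T -> normal T -> alg_norm alg T <= n ->
    exists Rs : C -> H -> H, (forall z, alg (Rs z)) /\
      (forall z, Cmod z <= rho -> alg_norm alg (Rs z) <= M) /\
      (forall z, spectral_gap T delta z -> is_inverse (op_shift T z) (Rs z)).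
Proof.
  intros [hclosed [h [_ [hbd hh]]]] hdelta.
  destruct (bounded_on_rectangle h (/ delta) (n + rho * alg_norm alg op_one) hbd) as [M [hM0 hM]].
  exists M. split; [easy|]. intros T hT hnorm hTn.
  assert (hex : forall z, exists V, alg V /\ (Cmod z <= rho -> alg_norm alg V <= M) /\
    (spectral_gap T delta z -> is_inverse (op_shift T z) V)).
  { intros z. destruct (classic (spectral_gap T delta z)) as [hz|hz].
    - assert (hinv : invertible_in BH (op_shift T z)).
      { apply NNPP. apply (hz z). replace (Cminus z z) with (RtoC 0) by ring.
        now rewrite Cmod_0. }
      destruct (hclosed _ (alg_shift alg T z hT) hinv) as [V [hV hVi]].
      exists V. split; [easy|]. split; [|easy]. intros hzr.
      pose proof (carrier_BH alg V hV) as hVB.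
      apply Rle_trans with (1 := hh (op_shift T z) V (alg_shift alg T z hT) hVB hVi).
      apply hM.
      + split; [now apply opnorm_ge0|].
        apply normal_resolvent_bound with T z; try easy. now apply (carrier_BH alg).
      + split; [apply alg_norm_ge0; now apply alg_shift|]. unfold op_shift.
        assert (h1 : alg (op_scal z op_one)) by apply carrier_scal, carrier_one.
        apply Rle_trans with (1 := alg_norm_minus alg T _ hT h1).
        rewrite alg_norm_scal by apply carrier_one.
        apply Rplus_le_compat; [easy|]. apply Rmult_le_compat_r; [|easy].
        apply alg_norm_ge0, carrier_one.
    - exists op_zero. split; [apply alg_zero|]. rewrite alg_norm_zero. easy. }
  destruct (choice _ hex) as [Rs hRs]. exists Rs. repeat split; intros; now apply hRs.
Qed.

Lemma Cmod_minus_sym (z w : C) : Cmod (Cminus z w) = Cmod (Cminus w z).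
Proof. replace (Cminus z w) with (Copp (Cminus w z)) by ring. apply Cmod_opp. Qed.

Lemma Cmod_minus_triangle (z w p : C) :
  Cmod (Cminus z p) <= Cmod (Cminus z w) + Cmod (Cminus w p).
Proof.
  replace (Cminus z p) with (Cplus (Cminus z w) (Cminus w p)) by ring. apply Cmod_triangle.
Qed.

Lemma near_centre_norm L m i j z : 0 < L -> (i < m)%nat -> (j < m)%nat ->
  Cmod (Cminus z (centre L m i j)) <= mesh L m / 2 -> Cmod z <= 2 * L.
Proof.
  intros hL hi hj hz. assert (hm : (0 < m)%nat) by lia.
  apply Rle_trans with (1 := Cmod_le_components z).
  pose proof (fst_le_Cmod (Cminus z (centre L m i j))) as h1.
  pose proof (snd_le_Cmod (Cminus z (centre L m i j))) as h2.
  cbn [fst snd Cminus Cplus Copp centre] in h1, h2.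
  assert (h3 := Rle_trans _ _ _ h1 hz). assert (h4 := Rle_trans _ _ _ h2 hz).
  apply Rabs_le_between in h3. apply Rabs_le_between in h4.
  pose proof (node_bounds L m hL hm i ltac:(lia)). pose proof (node_bounds L m hL hm j ltac:(lia)).
  pose proof (node_bounds L m hL hm (Datatypes.S i) ltac:(lia)) as h5.
  pose proof (node_bounds L m hL hm (Datatypes.S j) ltac:(lia)) as h6.
  unfold node in *. rewrite S_INR in h5, h6.
  assert (Rabs (fst z) <= L) by (apply Rabs_le; lra).
  assert (Rabs (snd z) <= L) by (apply Rabs_le; lra). lra.
Qed.

(* The squares in [chi] cover the spectrum of [A] and avoid that of [B], and the
   two resolvents are controlled along the edges separating [chi] from its
   complement. Hence [- grid_sum chi RA] and [- grid_sum chi RB] approximate the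
   Riesz projections of [A] and [B], up to the factor [box_winding]. *)
Lemma separating_grid (n : R) : norm_controlled_inversion alg -> 1 <= n ->
  exists L m M, 0 < L /\ (0 < m)%nat /\ 0 <= M /\ forall A B : H -> H,
    alg A -> alg B -> normal A -> normal B -> alg_norm alg A <= n -> alg_norm alg B <= n ->
    (forall z w, spectrum A z -> spectrum B w -> / n <= Cmod (Cminus z w)) ->
    exists chi RA RB, (forall z, alg (RA z)) /\ (forall z, alg (RB z)) /\
      (forall z, Cmod z <= 2 * L -> alg_norm alg (RA z) <= M /\ alg_norm alg (RB z) <= M) /\
      (forall G, (forall z, is_inverse (op_shift A z) (RA z) ->
           is_inverse (op_shift B z) (RB z) -> G z = op_zero) ->
         grid_sum L m chi G = op_zero) /\
      alg_norm alg (op_plus (grid_sum L m chi RA) (op_scal (box_winding L m) op_one)) <= 1 /\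
      alg_norm alg (grid_sum L m chi RB) <= 1.
Proof.
  intros halg hn.
  set (e := alg_norm alg op_one).
  assert (he : 0 <= e) by apply alg_norm_ge0, carrier_one.
  set (d := / n).
  assert (hd : 0 < d) by (apply Rinv_0_lt_compat; lra).
  assert (hd1 : d <= 1) by (unfold d; rewrite <- Rinv_1; apply Rinv_le_contravar; lra).
  (* [32 e n] makes the boundary error [16 e n / L] at most 1/2; [2 n + 1] keeps the boundary at
     distance at least 1 from both spectra. *)
  set (L := 32 * e * n + 2 * n + 1).
  assert (hen : 0 <= e * n) by (apply Rmult_le_pos; lra).
  assert (hL : 0 < L) by (unfold L; lra).
  destruct (controlled_resolvent n (d / 4) (2 * L) halg ltac:(lra)) as [M [hM0 hM]].
  assert (hM3 : 0 <= M ^ 3) by now apply pow_le.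
  assert (hL3 : 0 < L ^ 3) by now apply pow_lt.
  (* The first term makes the mesh at most [d / 4]. The second controls the quadrature error: at
     most [m^2] squares with error [(mesh M)^3] each, in all [8 L^3 M^3 / m]. *)
  destruct (INR_unbounded (8 * L / d + 16 * (L ^ 3 * M ^ 3))) as [m hmI].
  assert (hLd : 0 < 8 * L / d) by (apply Rdiv_lt_0_compat; lra).
  assert (hLM : 0 <= L ^ 3 * M ^ 3) by (apply Rmult_le_pos; lra).
  assert (hm : (0 < m)%nat) by (apply INR_lt; cbn; lra).
  pose proof (lt_0_INR m hm) as hmR.
  pose proof (mesh_pos L m hL hm) as hmesh.
  assert (hmd : mesh L m <= d / 4).
  { unfold mesh. apply Rmult_le_reg_r with (INR m * (4 / d)).
    - apply Rmult_lt_0_compat; [easy|]. apply Rdiv_lt_0_compat; lra.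
    - replace (2 * L / INR m * (INR m * (4 / d))) with (8 * L / d) by (field; lra).
      replace (d / 4 * (INR m * (4 / d))) with (INR m) by (field; lra). lra. }
  assert (htot : INR m * (INR m * (mesh L m ^ 3 * M ^ 3)) <= / 2).
  { replace (INR m * (INR m * (mesh L m ^ 3 * M ^ 3))) with (8 * (L ^ 3 * M ^ 3) / INR m)
      by (unfold mesh; field; lra).
    apply Rmult_le_reg_r with (INR m); [easy|].
    replace (8 * (L ^ 3 * M ^ 3) / INR m * INR m) with (8 * (L ^ 3 * M ^ 3)) by (field; lra). lra. }
  exists L, m, M. repeat (split; [easy|]). intros A B hA hB hnA hnB hAn hBn hsep.
  destruct (hM A hA hnA hAn) as [RA [hRA [hRAM hRAi]]].
  destruct (hM B hB hnB hBn) as [RB [hRB [hRBM hRBi]]].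
  (* Edge midpoints are within [mesh / 2 <= d / 8] of the centre. In a selected square they are
     farther than [d - d/2 - d/8] from the spectrum of [B], in any other at least [d/2 - d/8] from
     that of [A]; both exceed [d / 4]. *)
  set (P := fun i j => exists z, spectrum A z /\ Cmod (Cminus z (centre L m i j)) < d / 2).
  set (chi := fun i j => if excluded_middle_informative (P i j) then true else false).
  assert (hchi1 : forall i j p, chi i j = true ->
    Cmod (Cminus p (centre L m i j)) <= mesh L m / 2 -> spectral_gap B (d / 4) p).
  { intros i j p hc hp w hw hsw. unfold chi in hc.
    destruct (excluded_middle_informative (P i j)) as [[z [hz1 hz2]]|]; [|easy].
    specialize (hsep z w hz1 hsw). fold d in hsep.
    pose proof (Cmod_minus_triangle z (centre L m i j) w) as t1.
    pose proof (Cmod_minus_triangle (centre L m i j) p w) as t2.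
    rewrite (Cmod_minus_sym (centre L m i j) p), (Cmod_minus_sym p w) in t2. lra. }
  assert (hchi0 : forall i j p, chi i j = false ->
    Cmod (Cminus p (centre L m i j)) <= mesh L m / 2 -> spectral_gap A (d / 4) p).
  { intros i j p hc hp z hz hsz. unfold chi in hc.
    destruct (excluded_middle_informative (P i j)) as [|hno]; [easy|]. apply hno.
    exists z. split; [easy|]. pose proof (Cmod_minus_triangle z p (centre L m i j)). lra. }
  assert (hfar : forall T p, alg T -> alg_norm alg T <= n -> L <= Cmod p ->
    spectral_gap T (d / 4) p).
  { intros T p hT hTn hp w hw hsw. pose proof (spectrum_bounded alg T w hT hsw) as hb.
    pose proof (Cmod_triangle (Cminus p w) w) as ht.
    replace (Cplus (Cminus p w) w) with p in ht by ring.
    rewrite Cmod_minus_sym in ht. unfold L in hp. lra. }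
  assert (hbot : forall i j, Cmod (Cminus (hmid L m i j) (centre L m i j)) <= mesh L m / 2).
  { intros i j. rewrite hmid_bottom.
    match goal with |- Cmod ?z <= _ => replace z with (Copp (Cmult Ci (RtoC (mesh L m / 2)))) by ring end.
    rewrite Cmod_opp, Cmod_mult, Cmod_Ci, Cmod_R, Rabs_pos_eq; lra. }
  assert (htop : forall i j, Cmod (Cminus (hmid L m i (Datatypes.S j)) (centre L m i j)) <= mesh L m / 2).
  { intros i j. rewrite hmid_top by easy.
    match goal with |- Cmod ?z <= _ => replace z with (Cmult Ci (RtoC (mesh L m / 2))) by ring end.
    rewrite Cmod_mult, Cmod_Ci, Cmod_R, Rabs_pos_eq; lra. }
  assert (hright : forall i j, Cmod (Cminus (vmid L m (Datatypes.S i) j) (centre L m i j)) <= mesh L m / 2).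
  { intros i j. rewrite vmid_right by easy.
    match goal with |- Cmod ?z <= _ => replace z with (RtoC (mesh L m / 2)) by ring end.
    rewrite Cmod_R, Rabs_pos_eq; lra. }
  assert (hleft : forall i j, Cmod (Cminus (vmid L m i j) (centre L m i j)) <= mesh L m / 2).
  { intros i j. rewrite vmid_left by easy.
    match goal with |- Cmod ?z <= _ => replace z with (Copp (RtoC (mesh L m / 2))) by ring end.
    rewrite Cmod_opp, Cmod_R, Rabs_pos_eq; lra. }
  assert (hboth : forall i j i' j' p, chi i j <> chi i' j' ->
    Cmod (Cminus p (centre L m i j)) <= mesh L m / 2 ->
    Cmod (Cminus p (centre L m i' j')) <= mesh L m / 2 ->
    is_inverse (op_shift A p) (RA p) /\ is_inverse (op_shift B p) (RB p)).
  { intros i j i' j' p hne h1 h2.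
    destruct (chi i j) eqn:e1, (chi i' j') eqn:e2; try easy.
    - split; [now apply hRAi, (hchi0 i' j')|now apply hRBi, (hchi1 i j)].
    - split; [now apply hRAi, (hchi0 i j)|now apply hRBi, (hchi1 i' j')]. }
  assert (hsq : forall T Rs psi, (forall z, alg (Rs z)) ->
    (forall z, Cmod z <= 2 * L -> alg_norm alg (Rs z) <= M) ->
    (forall i j p, psi i j = true -> Cmod (Cminus p (centre L m i j)) <= mesh L m / 2 ->
       is_inverse (op_shift T p) (Rs p)) ->
    alg (grid_sum L m psi Rs) /\ alg_norm alg (grid_sum L m psi Rs) <= / 2).
  { intros T Rs psi h1 h2 h3. split.
    - apply alg_grid_sum. intros. now apply alg_edge_sum.
    - apply Rle_trans with (2 := htot). apply alg_norm_grid_sum.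
      + apply Rmult_le_pos; [apply pow_le; lra|easy].
      + intros i j hi hj hp. split; [now apply alg_edge_sum|].
        unfold square_sum. rewrite hmid_bottom, hmid_top, vmid_right, vmid_left by easy.
        apply resolvent_square_sum with T; try easy; [lra|].
        intros z hz. split; [now apply (h3 i j)|]. apply h2.
        now apply (near_centre_norm L m i j). }
  destruct m as [|k]; [lia|].
  exists chi, RA, RB. split; [easy|]. split; [easy|].
  split; [now split; [apply hRAM|apply hRBM]|]. split; [|split].
  - intros G hG.
    assert (hGb : forall p, L <= Cmod p -> G p = op_zero).
    { intros p hp. apply hG; [apply hRAi|apply hRBi]; now apply hfar. }
    rewrite (grid_sum_boundary L (Datatypes.S k) k); [|easy| |].
    + rewrite <- (op_sum_zero (Datatypes.S k)). apply op_sum_ext; intros i _.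
      rewrite !hGb by first [apply hmid_boundary_norm; auto | apply vmid_boundary_norm; auto].
      rewrite !op_if_zero. unfold edge_sum, op_zero. op_eq.
    + intros i j _ _. destruct (Bool.bool_dec (chi i j) (chi i (Datatypes.S j))) as [|hne]; [now left|right].
      destruct (hboth _ _ _ _ _ hne (htop i j) (hbot i (Datatypes.S j))). now apply hG.
    + intros i j _ _. destruct (Bool.bool_dec (chi i j) (chi (Datatypes.S i) j)) as [|hne]; [now left|right].
      destruct (hboth _ _ _ _ _ hne (hright i j) (hleft (Datatypes.S i) j)). now apply hG.
  (* The sum over all squares reduces to the outer boundary. The rejected squares contribute at most
     1/2, the resolvent of [A] being genuine on them, and subtracting them leaves the sum over
     [chi]. *)
  - assert (hfull : alg_norm alg (op_plus (grid_sum L (Datatypes.S k) (fun _ _ => true) RA)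
      (op_scal (box_winding L (Datatypes.S k)) op_one)) <= / 2).
    { rewrite (grid_sum_boundary L (Datatypes.S k) k) by auto. cbn [op_if].
      apply Rle_trans with (16 * e * n / L).
      - apply boundary_sum_resolvent with A; try easy; [unfold L; lra|].
        intros z hz. now apply hRAi, hfar.
      - apply Rmult_le_reg_r with L; [easy|].
        replace (16 * e * n / L * L) with (16 * e * n) by (field; lra). unfold L. lra. }
    destruct (hsq A RA (fun i j => negb (chi i j)) hRA hRAM) as [h1 h2].
    { intros i j p hp. apply Bool.negb_true_iff in hp. intros hz. now apply hRAi, (hchi0 i j). }
    assert (h3 : alg (grid_sum L (Datatypes.S k) (fun _ _ => true) RA)).
    { apply alg_grid_sum. intros. now apply alg_edge_sum. }
    assert (h4 : alg (op_scal (box_winding L (Datatypes.S k)) (op_one (H := H)))) by apply carrier_scal, carrier_one.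
    pose proof (grid_sum_split L (Datatypes.S k) chi RA) as hs.
    replace (op_plus (grid_sum L (Datatypes.S k) chi RA) _) with
      (op_minus (op_plus (grid_sum L (Datatypes.S k) (fun _ _ => true) RA)
         (op_scal (box_winding L (Datatypes.S k)) op_one))
         (grid_sum L (Datatypes.S k) (fun i j => negb (chi i j)) RA)) by (rewrite hs; op_eq).
    apply Rle_trans with (1 := alg_norm_minus alg _ _ (carrier_plus alg _ _ h3 h4) h1). lra.
  - destruct (hsq B RB chi hRB hRBM) as [h1 h2]; [|lra].
    intros i j p hp hz. now apply hRBi, (hchi1 i j).
Qed.

End SeparatingGrid.

(** * The Sylvester equation *)

Section Sylvester.
Context {H : HilbertSpace}.
Implicit Types (A B Q X Y : H -> H).

Lemma sylvester_bounded_solution (alg : BanachSubalgebra H) (n : R) :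
  norm_controlled_inversion alg -> 1 <= n ->
  exists K, 0 <= K /\ forall A B,
    alg A -> alg B -> normal A -> normal B -> alg_norm alg A <= n -> alg_norm alg B <= n ->
    (forall z w, spectrum A z -> spectrum B w -> / n <= Cmod (Cminus z w)) ->
    forall Q, alg Q -> exists X, alg X /\ alg_norm alg X <= K * alg_norm alg Q /\
      sylvester_solution A B Q X.
Proof.
  intros halg hn.
  destruct (separating_grid alg n halg hn) as [L [m [M [hL [hm [hM hgrid]]]]]].
  pose proof (mesh_pos L m hL hm) as hmesh. pose proof (pos_INR m) as hmR.
  set (K := INR m * (INR m * (4 * mesh L m * (M * M)))).
  assert (hMM : 0 <= M * M) by now apply Rmult_le_pos.
  assert (hK : 0 <= K) by (unfold K; do 2 (apply Rmult_le_pos; [easy|]); apply Rmult_le_pos; lra).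
  exists (2 * K). split; [lra|]. intros A B hA hB hnA hnB hAn hBn hsep.
  destruct (hgrid A B hA hB hnA hnB hAn hBn hsep)
    as [chi [RA [RB [hRA [hRB [hRM [hvanish [hPA hPB]]]]]]]].
  set (k := box_winding L m) in *.
  assert (hk : 4 <= Cmod k) by now apply box_winding_ge.
  assert (hk0 : k <> RtoC 0) by (intros h; rewrite h, Cmod_0 in hk; lra).
  set (PA := grid_sum L m chi RA) in *. set (PB := grid_sum L m chi RB) in *.
  assert (hPAa : alg PA) by (apply alg_grid_sum; intros; now apply alg_edge_sum).
  assert (hPBa : alg PB) by (apply alg_grid_sum; intros; now apply alg_edge_sum).
  assert (hPka : alg (op_plus PA (op_scal k op_one))).
  { apply carrier_plus; [easy|]. apply carrier_scal, carrier_one. }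
  assert (hik : Cmod (Cinv k) <= / 4).
  { rewrite Cmod_inv by easy. apply Rinv_le_contravar; lra. }
  pose proof (alg_norm_ge0 alg A hA) as hA0. pose proof (alg_norm_ge0 alg B hB) as hB0.
  assert (hL1 : forall X, alg X -> alg (op_minus (op_mult B X) (op_mult X A))).
  { intros X hX. apply alg_minus; now apply carrier_mult. }
  apply (alg_solve_of_approx alg (fun X => op_minus (op_mult B X) (op_mult X A))
    (alg_norm alg B + alg_norm alg A) K); try easy; [lra| | | |].
  - intros X Y hX hY. op_eq.
  - intros X Y hX hY. op_eq.
  - intros X hX. rewrite Rmult_plus_distr_r.
    apply Rle_trans with (1 := alg_norm_minus alg _ _
      (carrier_mult alg B X hB hX) (carrier_mult alg X A hX hA)).
    apply Rplus_le_compat; [now apply alg_norm_mult|].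
    rewrite (Rmult_comm (alg_norm alg A)). now apply alg_norm_mult.
  - intros Q hQ. pose proof (alg_norm_ge0 alg Q hQ) as hQ0.
    set (F := fun z => op_mult (RB z) (op_mult Q (RA z))).
    assert (hF : forall z, alg (F z)) by (intros z; apply carrier_mult; [easy|now apply carrier_mult]).
    assert (hFn : forall z, Cmod z <= 2 * L -> alg_norm alg (F z) <= M * M * alg_norm alg Q).
    { intros z hz. destruct (hRM z hz) as [h1 h2].
      replace (M * M * alg_norm alg Q) with (M * (alg_norm alg Q * M)) by ring.
      eapply Rle_trans; [apply alg_norm_mult; [easy|now apply carrier_mult]|].
      apply Rmult_le_compat; [now apply alg_norm_ge0|apply alg_norm_ge0; now apply carrier_mult|easy|].
      eapply Rle_trans; [now apply alg_norm_mult|]. now apply Rmult_le_compat_l. }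
    set (X0 := grid_sum L m chi F).
    assert (hX0 : alg X0) by (apply alg_grid_sum; intros; now apply alg_edge_sum).
    assert (hX0n : alg_norm alg X0 <= K * alg_norm alg Q).
    { replace (K * alg_norm alg Q)
        with (INR m * (INR m * (4 * mesh L m * (M * M * alg_norm alg Q)))) by (unfold K; ring).
      apply alg_norm_grid_sum.
      - apply Rmult_le_pos; [lra|now apply Rmult_le_pos].
      - intros i j hi hj _. split; [now apply alg_edge_sum|].
        apply alg_norm_edge_sum; try easy; [lra| | | |]; apply hFn;
          (apply hmid_norm || apply vmid_norm); lia || easy. }
    (* Where both resolvents are genuine, [B RB = 1 + z RB] and [RA A = 1 + z RA], and the terms in
       [z] cancel. [hvanish] asks for the identity at such points only. *)
    assert (hsyl : op_minus (op_mult B X0) (op_mult X0 A)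
      = op_minus (op_mult Q PA) (op_mult PB Q)).
    { assert (h0 : grid_sum L m chi (fun z =>
        op_minus (op_minus (op_mult B (F z)) (op_mult (F z) A))
                 (op_minus (op_mult Q (RA z)) (op_mult (RB z) Q))) = op_zero).
      { apply hvanish. intros z hzA hzB. apply functional_extensionality; intros x.
        pose proof (hRA z) as hRAz. pose proof (hRB z) as hRBz.
        unfold F, op_zero; unfold_op.
        rewrite (shift_inverse_app B (RB z) z _ hzB).
        rewrite (shift_inverse_app' A (RA z) z x (carrier_BH alg _ hRAz) hzA).
        linear. module. }
      rewrite grid_sum_minus, grid_sum_minus, grid_sum_minus in h0.
      rewrite <- (grid_sum_linear L m (op_mult B)) in h0 by now apply op_linear_mult_l, (carrier_BH alg).
      rewrite <- (grid_sum_linear L m (op_mult Q)) in h0 by now apply op_linear_mult_l, (carrier_BH alg).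
      rewrite <- (grid_sum_linear L m (fun X => op_mult X A)) in h0 by apply op_linear_mult_r.
      rewrite <- (grid_sum_linear L m (fun X => op_mult X Q)) in h0 by apply op_linear_mult_r.
      now apply op_minus_eq0. }
    exists (op_scal (Copp (Cinv k)) X0). split; [now apply carrier_scal|]. split.
    + rewrite alg_norm_scal, Cmod_opp by easy.
      pose proof (alg_norm_ge0 alg X0 hX0). pose proof (Cmod_ge_0 (Cinv k)). nra.
    (* The residual is [(Q (PA + k) - PB Q) / k], of norm at most [(1 + 1) / 4] times that of
       [Q]. *)
    + replace (op_minus Q _) with (op_scal (Cinv k)
        (op_minus (op_mult Q (op_plus PA (op_scal k op_one))) (op_mult PB Q))).
      2:{ transitivity (op_plus Q (op_scal (Cinv k) (op_minus (op_mult B X0) (op_mult X0 A)))).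
          - rewrite hsyl. apply functional_extensionality; intros x. unfold_op. linear.
            module; now field.
          - op_eq. }
      assert (h1 : alg (op_mult Q (op_plus PA (op_scal k op_one)))) by now apply carrier_mult.
      assert (h2 : alg (op_mult PB Q)) by now apply carrier_mult.
      rewrite alg_norm_scal by now apply alg_minus.
      pose proof (alg_norm_minus alg _ _ h1 h2) as e1.
      pose proof (alg_norm_mult alg _ _ hQ hPka) as e2.
      pose proof (alg_norm_mult alg _ _ hPBa hQ) as e3.
      pose proof (alg_norm_ge0 alg _ (alg_minus alg _ _ h1 h2)) as e4.
      pose proof (Cmod_ge_0 (Cinv k)). nra.
Qed.

(** Here the norm of the algebra is the operator norm, so [h s t = s] serves. *)
Lemma BH_norm_controlled : norm_controlled_inversion (BH_algebra (H := H)).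
Proof.
  split; [now intros T hT hi|]. exists (fun s _ => s). split; [easy|]. split.
  - intros K hK hq. destruct (cover_compact_bounded K hK) as [n hn]. exists (INR n).
    intros p hp. rewrite Rabs_pos_eq; [now apply hn|now apply hq].
  - intros T S _ _ _. cbn. lra.
Qed.

Lemma sylvester_homogeneous_trivial A B Y (d : R) :
  BH A -> BH B -> normal A -> normal B -> 0 < d ->
  (forall z w, spectrum A z -> spectrum B w -> d <= Cmod (Cminus z w)) ->
  BH Y -> op_mult B Y = op_mult Y A -> Y = op_zero.
Proof.
  intros hA hB hnA hnB hd hsep hY hcomm.
  set (alg := BH_algebra (H := H)).
  pose proof (opnorm_ge0 A hA) as hA0. pose proof (opnorm_ge0 B hB) as hB0.
  assert (hid : 0 < / d) by now apply Rinv_0_lt_compat.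
  set (n := 1 + opnorm A + opnorm B + / d).
  assert (hnd : / n <= d).
  { rewrite <- (Rinv_inv d). apply Rinv_le_contravar; [easy|unfold n; lra]. }
  destruct (separating_grid alg n BH_norm_controlled ltac:(unfold n; lra))
    as [L [m [M [hL [hm [hM hgrid]]]]]].
  destruct (hgrid A B hA hB hnA hnB) as [chi [RA [RB [hRA [hRB [_ [hvanish [hPA hPB]]]]]]]].
  - cbn. unfold n. lra.
  - cbn. unfold n. lra.
  - intros z w hz hw. specialize (hsep z w hz hw). lra.
  - set (k := box_winding L m) in *.
    assert (hk : 4 <= Cmod k) by now apply box_winding_ge.
    set (PA := grid_sum L m chi RA) in *. set (PB := grid_sum L m chi RB) in *.
    assert (hPAa : BH PA) by (apply (alg_grid_sum alg); intros; now apply (alg_edge_sum alg)).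
    assert (hPBa : BH PB) by (apply (alg_grid_sum alg); intros; now apply (alg_edge_sum alg)).
    assert (hint : op_mult Y PA = op_mult PB Y).
    { assert (h0 : grid_sum L m chi (fun z => op_minus (op_mult Y (RA z)) (op_mult (RB z) Y))
        = op_zero).
      { apply hvanish. intros z hzA hzB. apply functional_extensionality; intros x.
        assert (hRBz : BH (RB z)) by exact (hRB z).
        assert (hc : B (Y (RA z x)) = Y (A (RA z x))) by exact (f_equal (fun U => U (RA z x)) hcomm).
        rewrite (shift_inverse_app A (RA z) z x hzA), BH_map_plus, BH_map_scal in hc by easy.
        apply (f_equal (RB z)) in hc.
        rewrite (shift_inverse_app' B (RB z) z _ hRBz hzB) in hc.
        unfold op_zero; unfold_op. rewrite (BH_map_plus (RB z)), (BH_map_scal (RB z)) in hc by easy.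
        transitivity (minus (minus (plus (Y (RA z x)) (scal z (RB z (Y (RA z x)))))
          (scal z (RB z (Y (RA z x))))) (RB z (Y x))); [module|].
        rewrite hc. module. }
      rewrite grid_sum_minus in h0.
      rewrite <- (grid_sum_linear L m (op_mult Y)) in h0 by now apply op_linear_mult_l.
      rewrite <- (grid_sum_linear L m (fun X => op_mult X Y)) in h0 by apply op_linear_mult_r.
      now apply op_minus_eq0. }
    (* The right side has norm at most [2 |Y|] and the left at least [4 |Y|]. *)
    assert (hkY : op_scal k Y
      = op_minus (op_mult Y (op_plus PA (op_scal k op_one))) (op_mult PB Y)).
    { rewrite <- hint. op_eq. }
    cbn in hPA, hPB.
    pose proof (alg_norm_minus alg (op_mult Y (op_plus PA (op_scal k op_one))) (op_mult PB Y)
      ltac:(cbn; bounded) ltac:(cbn; bounded)) as e1. cbn in e1.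
    rewrite <- hkY, opnorm_scal in e1 by easy.
    pose proof (opnorm_mult Y (op_plus PA (op_scal k op_one)) hY ltac:(bounded)) as e2.
    pose proof (opnorm_mult PB Y hPBa hY) as e3.
    pose proof (opnorm_ge0 Y hY). apply opnorm_eq0; [easy|]. nra.
Qed.

End Sylvester.

Theorem theorem2p2 (H : HilbertSpace) (alg : BanachSubalgebra H)
  (halg : norm_controlled_inversion alg) (Q : H -> H) (hQ : alg Q) :
  exists g : R -> R -> R,
    bounded_on_compacts g /\
    forall A B : H -> H,
      alg A -> alg B -> normal A -> normal B ->
      (forall z : C, ~ (spectrum A z /\ spectrum B z)) ->
      exists X : H -> H,
        unique (fun Y => BH Y /\ sylvester_solution A B Q Y) X /\
        alg X /\
        alg_norm alg X <= g (/ spectral_dist A B) (alg_norm alg A + alg_norm alg B).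
Proof.
  (* The successor meets the requirement [1 <= n]. *)
  destruct (choice _ (fun k => sylvester_bounded_solution alg (INR (S k)) halg
    ltac:(rewrite S_INR; pose proof (pos_INR k); lra))) as [K hK].
  (* [Q] is fixed before [g], so its norm enters the constants. *)
  destruct (bounded_majorant (fun k => K k * alg_norm alg Q)) as [g [hg hgK]].
  exists g. split; [easy|]. intros A B hA hB hnA hnB hdis.
  pose proof (carrier_BH alg A hA) as hA'. pose proof (carrier_BH alg B hB) as hB'.
  pose proof (alg_norm_ge0 alg A hA) as hA0. pose proof (alg_norm_ge0 alg B hB) as hB0.
  destruct (hgK (/ spectral_dist A B) (alg_norm alg A + alg_norm alg B)) as [k [hk1 [hk2 hk3]]].
  (* A zero distance, as for empty spectra, has inverse 0 and stays in the quadrant. *)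
  - destruct (spectral_dist_ge0 A B) as [h|h].
    + left. now apply Rinv_0_lt_compat.
    + rewrite <- h, Rinv_0. lra.
  - lra.
  - pose proof (S_INR k) as hS. pose proof (pos_INR k) as hk0.
    assert (hsep := spectral_dist_separation A B (INR (S k)) hA' hB' ltac:(lra) hdis ltac:(lra)).
    destruct (proj2 (hK k) A B hA hB hnA hnB ltac:(lra) ltac:(lra) hsep Q hQ) as [X [hX [hXn hXs]]].
    pose proof (carrier_BH alg X hX) as hX'.
    exists X. split; [|split; [easy|lra]]. split; [easy|].
    intros Y [hY hYs]. apply op_minus_eq0.
    apply (sylvester_homogeneous_trivial A B _ (/ INR (S k))); try easy.
    + apply Rinv_0_lt_compat. lra.
    + bounded.
    + apply op_minus_eq0. unfold sylvester_solution in *.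
      transitivity (op_minus (op_minus (op_mult B X) (op_mult X A))
        (op_minus (op_mult B Y) (op_mult Y A))); [op_eq|].
      rewrite hXs, hYs. unfold op_zero. op_eq.
Qed.
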